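(* There is a Banach couple $(A_0,A_1)$ such that $A_0$ and $A_1$ are isometric to $l_1$, and for every exponential interpolation method $I$, the intermediate space $A_I$ contains a complemented subspace isomorphic to $c_0$.
   Context: Scalars are real or complex. A Banach couple $(A_0,A_1)$ is a pair of Banach spaces both (continuously) embedded in a common (Hausdorff) topological vector space. $A_0+A_1$ has norm $\|x\|=\inf\{\|x_0\|_{A_0}+\|x_1\|_{A_1}:x_0\in A_0,\ x_1\in A_1,\ x_0+x_1=x\}$ and $A_0\cap A_1$ has norm $\|x\|=\max\{\|x\|_{A_0},\|x\|_{A_1}\}$. A map $T:(A_0,A_1)\to(B_0,B_1)$ between couples is a linear map $T:A_0+A_1\to B_0+B_1$ with $T(A_i)\subseteq B_i$ and $\|T\|_{A_i\to B_i}<\infty$ for $i=0,1$. An interpolation method $I$ is a functor that takes each Banach couple $(A_0,A_1)$ to a Banach space $A_I$ with $A_0\cap A_1\subseteq A_I\subseteq A_0+A_1$ such that, for a constant $c$ depending only on $I$, $c^{-1}\|x\|_{A_0+A_1}\le\|x\|_{A_I}\le c\,\|x\|_{A_0\cap A_1}$, and such that if $T:(A_0,A_1)\to(B_0,B_1)$ is a map between couples then $T(A_I)\subseteq B_I$ with $\|T\|_{A_I\to B_I}<\infty$. It is exponential with exponent $\theta$ if $0<\theta<1$ and, for a constant $c$ depending only on $I$, $\|T\|_{A_I\to B_I}\le c\,\|T\|_{A_0\to B_0}^{1-\theta}\|T\|_{A_1\to B_1}^{\theta}$ for every map $T:(A_0,A_1)\to(B_0,B_1)$ between couples. It is an exponential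 interpolation method if it is exponential with some exponent $\theta\in(0,1)$. *)

(* Defs.v *)
From HB Require Import structures.
From mathcomp Require Import all_boot all_order all_algebra complex.
From mathcomp Require Import all_classical all_reals all_analysis.
Import Order.TTheory GRing.Theory Num.Theory.
Import numFieldNormedType.Exports.

Set Implicit Arguments.
Unset Strict Implicit.
Unset Printing Implicit Defensive.

Local Open Scope classical_set_scope.
Local Open Scope ring_scope.

Variant scalar_kind := RealScalars | ComplexScalars.

Definition scalar_field (R : realType) (k : scalar_kind) : numFieldType :=
  match k with
  | RealScalars => R
  | ComplexScalars => R[i]%C
  end.

Definition scalar_re (R : realType) (k : scalar_kind) : scalar_field R k -> R :=
  match k with
  | RealScalars => fun x => x
  | ComplexScalars => fun z => complex.Re z
  end.

Section Interpolation.
Variables (R : realType) (k : scalar_kind).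
Local Notation K := (scalar_field R k).

(* A norm over [K] takes its values in [K], where it is a nonnegative real
   scalar; [rnorm] is the same number seen in [R]. *)
Definition rnorm (V : normedZmodType K) (x : V) : R := scalar_re `|x|.

Record banach_in (E : lmodType K) := BanachIn {
  bspace :> completeNormedModType K ;
  emb : {linear bspace -> E} ;
  emb_inj : injective emb }.
Arguments emb {E} b.

Definition carrier (E : lmodType K) (X : banach_in E) : set E :=
  range (emb X).

(* The ambient space is not assumed to be locally convex. *)
Record banach_couple := BanachCouple {
  ambient : topologicalLmodType K ;
  ambient_hausdorff : hausdorff_space ambient ;
  space0 : banach_in ambient ;
  space1 : banach_in ambient ;
  emb0_continuous : continuous (emb space0) ;
  emb1_continuous : continuous (emb space1) }.

Definition sum_set (A : banach_couple) : set (ambient A) :=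
  [set x | exists (x0 : space0 A) (x1 : space1 A),
     emb (space0 A) x0 + emb (space1 A) x1 = x].

Definition sum_norm (A : banach_couple) (x : ambient A) : \bar R :=
  ereal_inf [set r | exists (x0 : space0 A) (x1 : space1 A),
     emb (space0 A) x0 + emb (space1 A) x1 = x /\
     r = (rnorm x0 + rnorm x1)%:E].

Definition inter_set (A : banach_couple) : set (ambient A) :=
  carrier (space0 A) `&` carrier (space1 A).

(* [x0] and [x1] are the same vector of the intersection, seen in the two
   spaces of the couple. *)
Definition inter_norm (A : banach_couple) (x0 : space0 A) (x1 : space1 A) : R :=
  Num.max (rnorm x0) (rnorm x1).

Definition maps_into (E F : lmodType K) (T : E -> F)
    (X : banach_in E) (Y : banach_in F) : Prop :=
  T @` carrier X `<=` carrier Y.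

(* Meaningful when [maps_into T X Y]; [+oo] when [T : X -> Y] is unbounded. *)
Definition opnorm (E F : lmodType K) (T : E -> F)
    (X : banach_in E) (Y : banach_in F) : \bar R :=
  ereal_sup [set r | exists (x : X) (y : Y),
     [/\ rnorm x <= 1, T (emb X x) = emb Y y & r = (rnorm y)%:E]].

Definition bounded_map (E F : lmodType K) (T : E -> F)
    (X : banach_in E) (Y : banach_in F) : Prop :=
  maps_into T X Y /\ (opnorm T X Y < +oo)%E.

(* Only the values of [T] on the sum of the couple [A] matter. *)
Definition couple_map (A B : banach_couple) (T : ambient A -> ambient B) : Prop :=
  [/\ forall (a : K) (x y : ambient A), sum_set x -> sum_set y ->
        T (a *: x + y) = a *: T x + T y,
      bounded_map T (space0 A) (space0 B)
    & bounded_map T (space1 A) (space1 B)].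

(* Morphisms act by restriction, so functoriality amounts to [imap]. *)
Record interpolation_method := InterpolationMethod {
  ispace :> forall A : banach_couple, banach_in (ambient A) ;
  inter_sub : forall A, inter_set (A := A) `<=` carrier (ispace A) ;
  sub_sum : forall A, carrier (ispace A) `<=` sum_set (A := A) ;
  inorm_equiv : exists2 c : R, 0 < c & forall A : banach_couple,
    (forall x : ispace A,
       (c^-1%:E * sum_norm (emb (ispace A) x) <= (rnorm x)%:E)%E) /\
    (forall (x : ispace A) (x0 : space0 A) (x1 : space1 A),
       emb (ispace A) x = emb (space0 A) x0 ->
       emb (ispace A) x = emb (space1 A) x1 ->
       rnorm x <= c * inter_norm x0 x1) ;
  imap : forall (A B : banach_couple) (T : ambient A -> ambient B),
    couple_map T -> bounded_map T (ispace A) (ispace B) }.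

Definition exponential_with (theta : R) (I : interpolation_method) : Prop :=
  0 < theta < 1 /\
  exists2 c : R, 0 < c &
    forall (A B : banach_couple) (T : ambient A -> ambient B), couple_map T ->
      (opnorm T (I A) (I B) <=
       c%:E * poweR (opnorm T (space0 A) (space0 B)) (1 - theta)
            * poweR (opnorm T (space1 A) (space1 B)) theta)%E.

Definition exponential (I : interpolation_method) : Prop :=
  exists theta : R, exponential_with theta I.

Definition l1_norm (u : nat -> K^o) : \bar R :=
  (\sum_(0 <= n <oo) (rnorm (u n))%:E)%E.

Definition l1_seq : set (nat -> K^o) := [set u | (l1_norm u < +oo)%E].

Definition sup_norm (u : nat -> K^o) : \bar R :=
  ereal_sup (range (fun n => (rnorm (u n))%:E)).

Definition c0_seq : set (nat -> K^o) := [set u | u @ \oo --> (0 : K^o)].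

Definition isometric_to_l1 (X : completeNormedModType K) : Prop :=
  exists J : {linear X -> (nat -> K^o)},
    range J = l1_seq /\ forall x : X, l1_norm (J x) = (rnorm x)%:E.

Definition complemented (X : completeNormedModType K) (Y : set X) : Prop :=
  exists P : {linear X -> X},
    [/\ continuous P, forall x, P (P x) = P x & range P = Y].

(* [Y] is a linear subspace of [X]; only the values of [J] on [Y] matter. *)
Definition isomorphic_to_c0 (X : completeNormedModType K) (Y : set X) : Prop :=
  exists J : X -> (nat -> K^o),
    [/\ forall (a : K) (x y : X), Y x -> Y y -> J (a *: x + y) = a *: J x + J y,
        J @` Y = c0_seq
      & exists a b : R, [/\ 0 < a, 0 < b & forall x : X, Y x ->
          ((a * rnorm x)%:E <= sup_norm (J x) <= (b * rnorm x)%:E)%E]].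

End Interpolation.

(* Main.v *)
From HB Require Import structures.
Require Import Defs.
From mathcomp Require Import all_boot all_order all_algebra complex.
From mathcomp Require Import all_classical all_reals all_analysis.
From mathcomp Require Import ring lra zify.
Import Order.TTheory GRing.Theory Num.Theory.
Import numFieldNormedType.Exports.

(** Consider the quotient map of l1 onto c0 that sends the unit vectors to
    finitely supported sequences of zeros and ones.  The couple [l1_couple]
    carries this quotient map simultaneously on both spaces, in such a way that
    the map has a bounded linear right inverse on every exponential
    intermediate space, although it can have none on l1.

    Let [d] range over the finite sets of natural numbers, coded by binary
    expansions ([bit]).  Up to the weights of [damp], an element of the ambient
    space consists of three sequences: [q], the value of the quotient map, and
    [u], [v], which are indexed by [d].  In the notation [(q, u, v)], both
    copies of l1 contain the vectors [(e_n, 0, 0)] and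
    [(1_d, eps_d e_d, eps_d e_d)] as unit vectors; the remaining unit vectors
    are, up to the factor [eps_d], the vectors [(0, 0, eps_d e_d)] in the first
    copy and the vectors [(0, eps_d e_d, 0)] in the second.  So the vector
    [(0, 0, eps_d e_d)] has norm [eps_d] in the first copy.  In the second copy
    it has to be written with the vector [(1_d, eps_d e_d, eps_d e_d)] and all
    the [(e_n, 0, 0)] with [n] in [d], and its norm is at most [d + 2]
    ([embed_small_large]); the other vector is treated symmetrically.

    The identity ([lift_bitsE])
      [(1_d, 0, 0) = (1_d, eps_d e_d, eps_d e_d) - (0, 0, eps_d e_d)
                     - (0, eps_d e_d, 0)]
    now decomposes [(1_d, 0, 0)] into three vectors of the intersection.  In an
    exponential intermediate space with exponent [theta], the norm of a vector
    is at most a constant times the weighted geometric mean of its two norms: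
    this is the exponential inequality for a rank-one map onto that vector
    ([interp_geometric_mean]).  Since [eps_d = exp (- d)], the three geometric
    means are bounded uniformly in [d] for every [theta] in ]0, 1[
    ([eps_pow_le]), so the vectors [(1_d, 0, 0)] are bounded in the
    intermediate space ([bits_in_interp]).

    A null sequence with values in [0, 1] is the sum of [2 ^ - (i + 1) 1_(d_i)],
    where [d_i] is the finite set of indices at which the [i]-th binary digit is
    one.  By completeness [a |-> (a, 0, 0)] maps c0 boundedly into the
    intermediate space ([lift_c0]).  The map to the slot [q] is bounded on the
    sum of the couple with values in c0, hence on the intermediate space, and
    is a left inverse.  Following it by the lift gives the projection
    ([lifted_c0_complemented]). *)

Set Implicit Arguments.
Unset Strict Implicit.
Unset Printing Implicit Defensive.

Local Open Scope classical_set_scope.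
Local Open Scope ring_scope.

(** * Real and complex scalars *)

Section Scalars.
Variables (R : realType) (k : scalar_kind).
Local Notation K := (scalar_field R k).

Definition of_real : R -> K :=
  match k return R -> scalar_field R k with
  | RealScalars => fun x => x
  | ComplexScalars => fun x => (x%:C)%C
  end.

Lemma of_realK (x : R) : scalar_re (of_real x) = x.
Proof. by rewrite /of_real /scalar_re; case: k. Qed.

Lemma of_realD (x y : R) : of_real (x + y) = of_real x + of_real y.
Proof. by rewrite /of_real; case: k => //=; rewrite rmorphD. Qed.

Lemma of_realM (x y : R) : of_real (x * y) = of_real x * of_real y.
Proof. by rewrite /of_real; case: k => //=; rewrite rmorphM. Qed.

Lemma of_realN (x : R) : of_real (- x) = - of_real x.
Proof. by rewrite /of_real; case: k => //=; rewrite rmorphN. Qed.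

Lemma of_real0 : of_real 0 = 0.
Proof. by rewrite /of_real; case: k. Qed.

Lemma of_real1 : of_real 1 = 1.
Proof. by rewrite /of_real; case: k. Qed.

Lemma of_real_le (x y : R) : (of_real x <= of_real y) = (x <= y).
Proof. by rewrite /of_real; case: k => //=; rewrite lecR. Qed.

Lemma of_real_lt (x y : R) : (of_real x < of_real y) = (x < y).
Proof. by rewrite /of_real; case: k => //=; rewrite ltcR. Qed.

Lemma of_real_real (x : R) : of_real x \is Num.real.
Proof. by rewrite realE -of_real0 !of_real_le; case: ltgtP. Qed.

Lemma of_real_scalar_re (x : K) : x \is Num.real -> of_real (scalar_re x) = x.
Proof. by rewrite /of_real /scalar_re; case: k x => //= x /RRe_real. Qed.

Lemma of_real_rnorm (V : normedZmodType K) (x : V) : of_real (rnorm x) = `|x|.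
Proof. exact/of_real_scalar_re/normr_real. Qed.

Lemma rnorm_le (V : normedZmodType K) (x : V) (r : R) :
  (rnorm x <= r) = (`|x| <= of_real r).
Proof. by rewrite -of_real_le of_real_rnorm. Qed.

Lemma rnorm_ge0 (V : normedZmodType K) (x : V) : 0 <= rnorm x.
Proof. by rewrite -of_real_le of_real_rnorm of_real0. Qed.

Lemma rnorm0 (V : normedZmodType K) : rnorm (0 : V) = 0.
Proof. by rewrite /rnorm normr0 -[in LHS]of_real0 of_realK. Qed.

Lemma rnorm0_eq0 (V : normedZmodType K) (x : V) : rnorm x = 0 -> x = 0.
Proof. by move=> x0; apply: normr0_eq0; rewrite -of_real_rnorm x0 of_real0. Qed.

Lemma rnormN (V : normedZmodType K) (x : V) : rnorm (- x) = rnorm x.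
Proof. by rewrite /rnorm normrN. Qed.

Lemma rnorm_sub (V : normedZmodType K) (x y : V) : rnorm (x - y) = rnorm (y - x).
Proof. by rewrite /rnorm distrC. Qed.

Lemma rnormD (V : normedZmodType K) (x y : V) :
  rnorm (x + y) <= rnorm x + rnorm y.
Proof. by rewrite rnorm_le of_realD !of_real_rnorm ler_normD. Qed.

Lemma rnormB (V : normedZmodType K) (x y : V) :
  rnorm (x - y) <= rnorm x + rnorm y.
Proof. by rewrite -[rnorm y]rnormN; exact: rnormD. Qed.

Lemma rnorm_sum (V : normedZmodType K) I (s : seq I) (P : pred I) (F : I -> V) :
  rnorm (\sum_(i <- s | P i) F i) <= \sum_(i <- s | P i) rnorm (F i).
Proof.
elim/big_ind2: _ => [|x a y b xa yb|//]; first by rewrite rnorm0.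
exact: le_trans (rnormD _ _) (lerD xa yb).
Qed.

Lemma rnormZ (V : normedModType K) (a : K) (x : V) :
  rnorm (a *: x) = rnorm (a : K^o) * rnorm x.
Proof.
rewrite -[RHS]of_realK of_realM !of_real_rnorm.
by rewrite -[LHS]of_realK of_real_rnorm normrZ.
Qed.

Lemma rnormM (a b : K^o) : rnorm (a * b : K^o) = rnorm a * rnorm b.
Proof. exact: (@rnormZ K^o). Qed.

Lemma rnorm_of_real (r : R) : rnorm (of_real r : K^o) = `|r|.
Proof.
have h (s : R) : 0 <= s -> rnorm (of_real s : K^o) = s.
  move=> s0; rewrite -[LHS]of_realK of_real_rnorm ger0_norm ?of_realK//.
  by rewrite -of_real0 of_real_le.
have [r0|r0] := leP 0 r; first by rewrite h// ger0_norm.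
by rewrite ltr0_norm// -[in LHS](opprK r) of_realN rnormN h// oppr_ge0 ltW.
Qed.

Lemma rnorm1 : rnorm (1 : K^o) = 1.
Proof. by rewrite -of_real1 rnorm_of_real normr1. Qed.

(** Imaginary parts and the imaginary unit are zero over the reals: splitting
    a scalar into two real parts is then a single statement for both kinds of
    scalars. *)
Definition scalar_im : K -> R :=
  match k return scalar_field R k -> R with
  | RealScalars => fun=> 0
  | ComplexScalars => fun z => complex.Im z
  end.

Definition imag_unit : K :=
  match k return scalar_field R k with
  | RealScalars => 0
  | ComplexScalars => 'i%C
  end.

Lemma scalarE (x : K) :
  x = of_real (scalar_re x) + imag_unit * of_real (scalar_im x).
Proof.
rewrite /of_real /scalar_re /scalar_im /imag_unit; case: k x => /= x.
  by rewrite mul0r addr0.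
exact: complexE.
Qed.

Lemma rnorm_imag_unit : rnorm (imag_unit : K^o) <= 1.
Proof.
rewrite /rnorm /imag_unit /scalar_re; case: k => /=; first by rewrite normr0.
apply: (@le_trans _ _ (complex.Re `|'i%C : R[i]%C|)); first exact: lexx.
by rewrite normc_def/= expr0n expr1n/= add0r sqrtr1.
Qed.

Lemma scalar_reB (x y : K) : scalar_re (x - y) = scalar_re x - scalar_re y.
Proof. by rewrite /scalar_re; case: k x y => //= x y; rewrite raddfB. Qed.

Lemma scalar_imB (x y : K) : scalar_im (x - y) = scalar_im x - scalar_im y.
Proof.
by rewrite /scalar_im; case: k x y => /= x y; rewrite ?subr0 ?raddfB.
Qed.

Lemma scalar_re_le (x : K^o) : `|scalar_re x| <= rnorm x.
Proof.
rewrite -of_real_le of_real_rnorm /scalar_re /of_real.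
by case: k x => //= x; exact: normc_ge_Re.
Qed.

Lemma scalar_im_le (x : K^o) : `|scalar_im x| <= rnorm x.
Proof.
rewrite -of_real_le of_real_rnorm /scalar_im /of_real.
case: k x => /= x; first by rewrite normr0 normr_ge0.
rewrite -[complex.Im x]opprK normrN -ReiNIm (le_trans (normc_ge_Re _))//.
by rewrite normrM [`|'i%C|]normc_def/= expr0n expr1n/= add0r sqrtr1 mulr1.
Qed.

(** Radii of balls are positive elements of [K], hence real; this turns every
    epsilon of [K] into one of [R]. *)
Lemma gt0_of_real (e : K) : 0 < e -> exists2 r : R, 0 < r & e = of_real r.
Proof.
move=> e0; have re : of_real (scalar_re e) = e.
  by apply: of_real_scalar_re; exact: gtr0_real.
by exists (scalar_re e) => //; rewrite -of_real_lt re of_real0.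
Qed.

Lemma cvg_rnormP (V : normedModType K) T (F : set_system T) (f : T -> V) (l : V) :
  Filter F ->
  (f x @[x --> F] --> l) <->
  (forall e : R, 0 < e -> \forall x \near F, rnorm (l - f x) <= e).
Proof.
move=> FF; split=> [/cvgrPdist_le fl e e0|fl].
  have /fl : 0 < of_real e by rewrite -of_real0 of_real_lt.
  by apply: filterS => x; rewrite rnorm_le.
apply/cvgrPdist_le => _ /gt0_of_real[e e0 ->].
by have := fl e e0; apply: filterS => x; rewrite rnorm_le.
Qed.

Lemma rnorm_lim_le (V : normedModType K) T (F : set_system T) (f : T -> V)
    (l : V) (M : R) :
  ProperFilter F -> f x @[x --> F] --> l ->
  (\forall x \near F, rnorm (f x) <= M) -> rnorm l <= M.
Proof.
move=> FF /cvg_rnormP fl fM; apply/ler_addgt0Pr => e e0.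
near F => x.
rewrite -(subrK (f x) l) (le_trans (rnormD _ _))// addrC lerD//.
  by near: x.
by near: x; exact: fl.
Unshelve. all: by end_near. Qed.

Lemma bounded_linear_cont (V W : normedModType K) (f : {linear V -> W}) (M : R) :
  (forall x, rnorm (f x) <= M * rnorm x) -> continuous f.
Proof.
move=> fM; apply: bounded_linear_continuous; apply/linear_boundedP.
near=> r => x; rewrite -!of_real_rnorm.
apply: (@le_trans _ _ (of_real M * of_real (rnorm x))).
  by rewrite -of_realM of_real_le.
rewrite ler_wpM2r//; first by rewrite -of_real0 of_real_le rnorm_ge0.
by near: r; apply: nbhs_pinfty_ge; exact: of_real_real.
Unshelve. all: by end_near. Qed.

End Scalars.

(** * Cauchy criteria and absolute convergence *)

Section Completeness.
Variables (R : realType) (k : scalar_kind).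
Local Notation K := (scalar_field R k).

(** The Cauchy criterion along a filter, with real radii; along [\oo] it is the
    usual notion for sequences. *)
Definition cauchy_along (V : normedModType K) T (F : set_system T) (f : T -> V) :=
  forall e : R, 0 < e ->
    exists2 A, F A & forall x y, A x -> A y -> rnorm (f x - f y) <= e.

Lemma cauchy_along_cauchy (V : normedModType K) T (F : set_system T) (f : T -> V) :
  ProperFilter F -> cauchy_along F f -> cauchy (f x @[x --> F]).
Proof.
move=> FF fc; apply: cauchy_exP => _ /gt0_of_real[e e0 ->].
have [|A FA Ae] := fc (e / 2); first by rewrite divr_gt0.
have [x Ax] := filter_ex FA.
exists (f x); rewrite /fmap/=; apply: (filterS _ FA) => y Ay /=.
rewrite -ball_normE /ball_/=.
by rewrite -of_real_rnorm of_real_lt (le_lt_trans (Ae _ _ Ax Ay))// gtr_pMr//; lra.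
Qed.

Lemma cauchy_cauchy_along (V : normedModType K) (F : set_system V) :
  ProperFilter F -> cauchy F -> cauchy_along F (fun x : V => x).
Proof.
move=> FF /cauchyP Fc e e0.
have [|x Fx] := Fc (of_real k (e / 2)).
  by rewrite -(of_real0 R k) of_real_lt divr_gt0.
exists (ball x (of_real k (e / 2))) => // y z.
rewrite -!ball_normE /ball_/= -!of_real_rnorm !of_real_lt => xy xz.
rewrite (_ : y - z = (y - x) + (x - z)); last by rewrite addrA subrK.
rewrite (le_trans (rnormD _ _))// rnorm_sub; lra.
Qed.

(** Stated for sequences, this makes sense for the scalars as well as for
    Banach spaces. *)
Definition seq_complete (V : normedModType K) := forall u : nat -> V,
  cauchy_along \oo u -> exists l : V, u n @[n --> \oo] --> l.

Lemma banach_seq_complete (V : completeNormedModType K) : seq_complete V.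
Proof.
move=> u /cauchy_along_cauchy uc; exists (lim (u n @[n --> \oo])).
exact: (cauchy_cvg (T := V)).
Qed.

(** Comparison test.  The partial sums of [u] oscillate less than those of [b],
    which increase and are bounded. *)
Lemma abs_summable (V : normedModType K) (u : nat -> V) (b : nat -> R) (M : R) :
  seq_complete V -> (forall n, rnorm (u n) <= b n) ->
  (forall n, \sum_(i < n) b i <= M) ->
  exists2 l : V, (\sum_(i < n) u i) @[n --> \oo] --> l & rnorm l <= M.
Proof.
move=> Vc ub bM.
have b0 n : 0 <= b n by rewrite (le_trans (rnorm_ge0 (u n))).
pose B n := \sum_(i < n) b i.
have ndB : {homo B : m n / (m <= n)%N >-> m <= n}.
  apply: homo_leq => [//|y x z|n]; first exact: le_trans.
  by rewrite /B big_ord_recr/= lerDl.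
have cB : cvgn B.
  by apply: nondecreasing_is_cvgn => //; exists M => _ [n _ <-]; exact: bM.
have dist m n : (n <= m)%N ->
    rnorm (\sum_(i < m) u i - \sum_(i < n) u i) <= B m - B n.
  move=> nm; rewrite /B -!(big_mkord xpredT).
  rewrite !(@big_cat_nat _ _ _ n 0 m)//= !(addrC _ (\sum_(n <= i < m) _)) !addrK.
  by rewrite (le_trans (rnorm_sum _ _ _))// ler_sum.
have Bl n : B n <= limn B by exact: nondecreasing_cvgn_le.
have [|l ul] := Vc (fun n => \sum_(i < n) u i).
  move=> e e0; have /cvgrPdist_le/(_ e e0) := cB.
  case=> N _ Ne; exists [set n | (N <= n)%N]; first by exists N.
  move=> m n /= Nm Nn; wlog nm : m n Nm Nn / (n <= m)%N => [hw|].
    by have [nm|/ltnW mn] := leqP n m; [|rewrite rnorm_sub]; exact: hw.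
  rewrite (le_trans (dist _ _ nm))//.
  have := Ne _ Nn; rewrite ler_norml => /andP[_].
  by have := Bl m; lra.
exists l => //; apply: rnorm_lim_le ul _.
near=> n; rewrite (le_trans (rnorm_sum _ _ _))//.
by rewrite (le_trans _ (bM n))// ler_sum.
Unshelve. all: by end_near. Qed.

End Completeness.

Section ScalarCompleteness.

Lemma real_cauchy_cvg (R : realType) T (F : set_system T) (f : T -> R) :
  ProperFilter F ->
  (forall e : R, 0 < e ->
    exists2 A, F A & forall x y, A x -> A y -> `|f x - f y| <= e) ->
  exists l : R, f x @[x --> F] --> l.
Proof.
move=> FF fc; exists (lim (f x @[x --> F])); apply: (cauchy_cvg (T := R)).
exact: (@cauchy_along_cauchy R RealScalars R^o).
Qed.

(** Real and imaginary parts of a Cauchy family are Cauchy families in [R]. *)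
Lemma scalar_cauchy_cvg (R : realType) (k : scalar_kind)
    T (F : set_system T) (f : T -> (scalar_field R k)^o) :
  ProperFilter F -> cauchy_along F f ->
  exists l : (scalar_field R k)^o, f x @[x --> F] --> l.
Proof.
move=> FF fc.
have [a fa] : exists a : R, scalar_re (f x) @[x --> F] --> a.
  apply: real_cauchy_cvg => e /fc[A FA Ae]; exists A => // x y Ax Ay.
  by rewrite -scalar_reB (le_trans (scalar_re_le _))// Ae.
have [b fb] : exists b : R, scalar_im (f x) @[x --> F] --> b.
  apply: real_cauchy_cvg => e /fc[A FA Ae]; exists A => // x y Ax Ay.
  by rewrite -scalar_imB (le_trans (scalar_im_le _))// Ae.
exists (of_real k a + imag_unit R k * of_real k b); apply/cvg_rnormP => e e0.
have e20 : 0 < e / 2 by rewrite divr_gt0.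
move/cvgrPdist_le: fa => /(_ _ e20) fa; move/cvgrPdist_le: fb => /(_ _ e20) fb.
near=> x.
rewrite {1}[f x]scalarE opprD addrACA -mulrBr -!of_realN -!of_realD.
rewrite (le_trans (rnormD _ _))// rnormM !rnorm_of_real.
rewrite [leRHS]splitr lerD//; first by near: x.
apply: (@le_trans _ _ (1 * (e / 2))); last by rewrite mul1r.
by rewrite ler_pM ?rnorm_ge0 ?rnorm_imag_unit//; near: x.
Unshelve. all: by end_near. Qed.

End ScalarCompleteness.

(** * The Banach space l1 *)

Section SpaceL1.
Variables (R : realType) (k : scalar_kind).
Local Notation K := (scalar_field R k).

(** All estimates of l1 norms are made on finite partial sums through this
    equivalence, which avoids arithmetic on infinite sums. *)
Lemma l1_norm_leP (u : nat -> K^o) (M : R) :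
  (l1_norm u <= M%:E)%E <-> forall n, \sum_(i < n) rnorm (u i) <= M.
Proof.
have u0 i : (0 <= i)%N -> true -> (0 <= (rnorm (u i))%:E)%E.
  by rewrite lee_fin rnorm_ge0.
split=> [uM n|uM].
  rewrite -lee_fin (le_trans _ uM)// -sumEFin.
  rewrite -(big_mkord xpredT (fun i => (rnorm (u i))%:E)).
  exact: nneseries_lim_ge.
apply: lime_le; first exact: is_cvg_nneseries.
by near=> n; rewrite big_mkord sumEFin lee_fin.
Unshelve. all: by end_near. Qed.

Lemma l1_norm_ge0 (u : nat -> K^o) : (0 <= l1_norm u)%E.
Proof. by apply: nneseries_ge0 => i _ _; rewrite lee_fin rnorm_ge0. Qed.

Lemma l1_seqP (u : nat -> K^o) :
  l1_seq u <-> exists M, forall n, \sum_(i < n) rnorm (u i) <= M.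
Proof.
split=> [uoo|[M /l1_norm_leP uM]]; last exact: le_lt_trans uM (ltry _).
exists (fine (l1_norm u)); apply/l1_norm_leP.
by rewrite fineK// ge0_fin_numE// l1_norm_ge0.
Qed.

Definition l1_pred : {pred nat -> K^o} := mem (@l1_seq R k).

Lemma l1_submod_closed : submod_closed l1_pred.
Proof.
split=> [|a u v]; rewrite !inE.
  by apply/l1_seqP; exists 0 => n; rewrite big1// => i _; rewrite rnorm0.
move=> /l1_seqP[M uM] /l1_seqP[N vN].
apply/l1_seqP; exists (rnorm (a : K^o) * M + N) => n.
apply: (@le_trans _ _
  (\sum_(i < n) (rnorm (a : K^o) * rnorm (u i) + rnorm (v i)))).
  apply: ler_sum => i _; rewrite (le_trans (rnormD _ _))// lerD//.
  by rewrite (rnormZ (V := K^o)).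
by rewrite big_split/= -mulr_sumr lerD ?vN// ler_wpM2l ?rnorm_ge0 ?uM.
Qed.

HB.instance Definition _ := GRing.isSubmodClosed.Build _ _ l1_pred l1_submod_closed.

Record l1_space := L1Space { l1_val :> nat -> K^o ; l1_valP : l1_val \in l1_pred }.

HB.instance Definition _ := [isSub for l1_val].
HB.instance Definition _ := [Choice of l1_space by <:].
HB.instance Definition _ := [SubChoice_isSubLmodule of l1_space by <:].

Lemma l1_spaceP (z : l1_space) : l1_seq z.
Proof. exact/set_mem/l1_valP. Qed.

Lemma l1_ext (y z : l1_space) : y =1 z -> y = z.
Proof. by move=> yz; apply: val_inj; apply: funext. Qed.

Definition l1_rnorm (z : l1_space) : R := fine (l1_norm z).

Lemma l1_rnormE (z : l1_space) : (l1_rnorm z)%:E = l1_norm z.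
Proof. by rewrite fineK// ge0_fin_numE ?l1_norm_ge0//; exact: l1_spaceP. Qed.

Lemma l1_rnorm_leP (z : l1_space) (M : R) :
  l1_rnorm z <= M <-> forall n, \sum_(i < n) rnorm (z i) <= M.
Proof. by rewrite -lee_fin l1_rnormE; exact: l1_norm_leP. Qed.

Lemma l1_sum_le (z : l1_space) n : \sum_(i < n) rnorm (z i) <= l1_rnorm z.
Proof. by move: n; apply/l1_rnorm_leP. Qed.

Lemma l1_rnormD (y z : l1_space) : l1_rnorm (y + z) <= l1_rnorm y + l1_rnorm z.
Proof.
apply/l1_rnorm_leP => n.
apply: (@le_trans _ _ (\sum_(i < n) (rnorm (y i) + rnorm (z i)))).
  by apply: ler_sum => i _; exact: rnormD.
by rewrite big_split/= lerD// l1_sum_le.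
Qed.

Lemma l1_rnormZ_le a (z : l1_space) :
  l1_rnorm (a *: z) <= rnorm (a : K^o) * l1_rnorm z.
Proof.
apply/l1_rnorm_leP => n.
rewrite (eq_bigr (fun i : 'I_n => rnorm (a : K^o) * rnorm (z i))).
  by rewrite -mulr_sumr ler_wpM2l ?rnorm_ge0// l1_sum_le.
by move=> i _; rewrite -(rnormZ (V := K^o)).
Qed.

(** The reverse inequality is [l1_rnormZ_le] for the inverse scalar. *)
Lemma l1_rnormZ a (z : l1_space) :
  l1_rnorm (a *: z) = rnorm (a : K^o) * l1_rnorm z.
Proof.
have [->|a0] := eqVneq a 0.
  rewrite scale0r rnorm0 mul0r; apply/eqP; rewrite eq_le.
  apply/andP; split; last by have := l1_sum_le 0 0; rewrite big_ord0.
  by have := l1_rnormZ_le 0 0; rewrite scale0r rnorm0 mul0r.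
apply/eqP; rewrite eq_le l1_rnormZ_le/=.
have := l1_rnormZ_le a^-1 (a *: z); rewrite scalerA mulVf// scale1r.
move=> /(ler_wpM2l (rnorm_ge0 (a : K^o))).
by rewrite mulrA -rnormM mulfV// rnorm1 mul1r.
Qed.

Lemma l1_coord_le (z : l1_space) n : rnorm (z n) <= l1_rnorm z.
Proof.
apply: le_trans (l1_sum_le z n.+1).
by rewrite big_ord_recr/= lerDr sumr_ge0// => i _; exact: rnorm_ge0.
Qed.

Let knorm (z : l1_space) : K := of_real k (l1_rnorm z).

Let knormD y z : knorm (y + z) <= knorm y + knorm z.
Proof. by rewrite /knorm -of_realD of_real_le l1_rnormD. Qed.

Let knormZ a z : knorm (a *: z) = `|a| * knorm z.
Proof. by rewrite /knorm l1_rnormZ of_realM (of_real_rnorm (a : K^o)). Qed.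

Let knorm0_eq0 z : knorm z = 0 -> z = 0.
Proof.
rewrite /knorm => z0; apply: l1_ext => n; apply: rnorm0_eq0.
apply/eqP; rewrite eq_le rnorm_ge0 andbT (le_trans (l1_coord_le z n))//.
by rewrite -(of_real_le k) z0 of_real0.
Qed.

HB.instance Definition _ :=
  Lmodule_isNormed.Build K l1_space knormD knormZ knorm0_eq0.

Lemma rnorm_l1 (z : l1_space) : rnorm z = l1_rnorm z.
Proof. by rewrite /rnorm [`|z|]/(knorm z) /knorm of_realK. Qed.

(** A Cauchy filter converges coordinatewise because the scalars are complete;
    the coordinatewise limit is then shown to be a limit in norm. *)
Lemma l1_complete (F : set_system l1_space) : ProperFilter F -> cauchy F -> cvg F.
Proof.
move=> FF /cauchy_cauchy_along Fc.
have dist (y z : l1_space) n : \sum_(i < n) rnorm (y i - z i) <= rnorm (y - z).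
  by rewrite rnorm_l1; exact: (l1_sum_le (y - z)).
have /choice[l Fl] n : exists l : K^o, (fun z : l1_space => z n) @ F --> l.
  apply: scalar_cauchy_cvg => e /Fc[A FA Ae]; exists A => // x y Ax Ay.
  by rewrite (le_trans _ (Ae _ _ Ax Ay))// rnorm_l1 (l1_coord_le (x - y)).
(* coordinatewise limits inherit the uniform bounds on partial sums *)
have tail e A : F A -> (forall x y, A x -> A y -> rnorm (x - y) <= e) ->
    forall x, A x -> forall n, \sum_(i < n) rnorm (l i - x i) <= e.
  move=> FA Ae x Ax n; apply/ler_addgt0Pr => d d0.
  have dn0 : 0 < d / n.+1%:R by rewrite divr_gt0.
  have nl : \forall y \near (F : set_system l1_space),
      forall i : 'I_n, rnorm (l i - (y : l1_space) i) <= d / n.+1%:R.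
    by apply: filter_forall => i; have /cvg_rnormP := Fl i; exact.
  (* compare with a point [y] of [A] whose first [n] entries are near [l] *)
  near F => y.
  apply: (@le_trans _ _ (\sum_(i < n) (d / n.+1%:R + rnorm (y i - x i)))).
    apply: ler_sum => i _; rewrite -(subrK (y i) (l i)) -addrA.
    rewrite (le_trans (rnormD _ _))// lerD//.
    by move: (i); near: y.
  rewrite big_split/= addrC lerD//.
    by rewrite (le_trans (dist _ _ _))// Ae//; near: y.
  rewrite sumr_const card_ord  -[_ *+ n]mulr_natr mulrAC ler_pdivrMr//.
  by rewrite ler_wpM2l ?ltW// ltr_nat.
have [A FA Ae] := Fc 1 ltr01; have [x Ax] := filter_ex FA.
have ll : l \in l1_pred.
  rewrite inE; apply/l1_seqP; exists (1 + l1_rnorm x) => n.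
  apply: (@le_trans _ _ (\sum_(i < n) (rnorm (l i - x i) + rnorm (x i)))).
    by apply: ler_sum => i _; rewrite -{1}(subrK (x i) (l i)) rnormD.
  by rewrite big_split/= lerD ?l1_sum_le//; exact: tail Ax _.
apply/cvg_ex; exists (L1Space ll); apply/cvg_rnormP => e /Fc[B FB Be].
apply: (filterS _ (FB)) => y By; rewrite rnorm_l1; apply/l1_rnorm_leP => n.
exact: (tail e B FB Be y By n).
Unshelve. all: by end_near. Qed.

HB.instance Definition _ := Uniform_isComplete.Build l1_space l1_complete.

Lemma l1_space_isometric : isometric_to_l1 l1_space.
Proof.
have lv : linear (l1_val : l1_space -> (nat -> K^o)) by move=> a y z.
pose J : {linear l1_space -> (nat -> K^o)} :=
  HB.pack (l1_val : l1_space -> (nat -> K^o)) (GRing.isLinear.Build _ _ _ _ _ lv).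
exists J; split=> [|z]; last by rewrite rnorm_l1 l1_rnormE.
apply/seteqP; split=> [_ [z _ <-]|u u1]; first exact: l1_spaceP.
by exists (L1Space (mem_set u1)).
Qed.

End SpaceL1.

(** * Geometric mean bounds in exponential intermediate spaces *)

Section Interpolation.
Variables (R : realType) (k : scalar_kind).
Local Notation K := (scalar_field R k).

Section RankOne.
Variables (E : lmodType K) (X : banach_in E) (f : E -> K^o) (x : X).
Hypotheses (fl : linear f) (fX : forall z, rnorm (f (emb X z)) <= rnorm z).

Let T (y : E) : E := f y *: emb X x.

Let TE z : T (emb X z) = emb X (f (emb X z) *: x).
Proof. by rewrite linearZ. Qed.

Lemma rank_one_maps_into : maps_into T X X.
Proof. by move=> _ [_ [z _ <-] <-]; exists (f (emb X z) *: x). Qed.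

(** The rank-one map [y |-> f y *: x] factors through the scalars, and the unit
    ball of [X] is mapped into the unit ball of the scalars by [f]. *)
Lemma rank_one_opnorm : (0 <= opnorm T X X <= (rnorm x)%:E)%E.
Proof.
apply/andP; split.
  apply: ereal_sup_ubound; exists 0, (f (emb X 0) *: x); split.
  - by rewrite rnorm0 ler01.
  - exact: TE.
  - congr (_%:E); apply/eqP; rewrite eq_le rnorm_ge0/= rnormZ.
    by rewrite -[leRHS](mul0r (rnorm x)) ler_wpM2r ?rnorm_ge0// -(rnorm0 X).
apply: ge_ereal_sup => _ [z [y [z1 Ty ->]]].
have <- : f (emb X z) *: x = y by apply: (@emb_inj _ _ _ X); rewrite -TE.
rewrite lee_fin rnormZ ler_piMl ?rnorm_ge0//; exact: le_trans z1.
Qed.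

Lemma rank_one_bounded : bounded_map T X X.
Proof.
split; first exact: rank_one_maps_into.
by case/andP: rank_one_opnorm => _ /le_lt_trans; apply; exact: ltry.
Qed.

End RankOne.

Variables (A : banach_couple R k) (I : interpolation_method R k).

(** Such a functional is bounded on the sum of the couple, with the same
    bound [M]. *)
Definition couple_functional (M : R) (f : ambient A -> K^o) :=
  [/\ linear f, forall z, rnorm (f (emb (space0 A) z)) <= M * rnorm z
    & forall z, rnorm (f (emb (space1 A) z)) <= M * rnorm z].

(** The constant is that of the embedding of [I A] into the sum of the couple,
    so it serves all functionals at once. *)
Lemma interp_functional_le : exists2 C : R, 0 < C &
  forall M (f : ambient A -> K^o), 0 < M -> couple_functional M f ->
  forall y : I A, rnorm (f (emb (I A) y)) <= C * M * rnorm y.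
Proof.
have [c c0 /(_ A)[cI _]] := inorm_equiv I.
exists c => // M f M0 [fl f0 f1] y.
have fy : (((rnorm (f (emb (I A) y))) / M)%:E <= sum_norm (emb (I A) y))%E.
  apply: le_ereal_inf_tmp => _ [z0 [z1 [<- ->]]]; rewrite lee_fin.
  rewrite ler_pdivrMr// mulrC mulrDr.
  rewrite -[emb _ z0]scale1r fl scale1r (le_trans (rnormD _ _))//.
  by rewrite lerD.
rewrite -mulrA mulrCA -ler_pdivrMl// mulrC -ler_pdivrMl//.
rewrite -lee_fin EFinM (le_trans _ (cI y))//.
by rewrite lee_wpmul2l// lee_fin invr_ge0 ltW.
Qed.

(** For a vector [x] of the intersection, the map [y |-> f y *: x] has norm at
    most [rnorm x0] on the first space and [rnorm x1] on the second, and sends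
    a fixed vector of [I A] to [x]. *)
Lemma interp_geometric_mean (theta : R) (f : ambient A -> K^o)
    (e0 : space0 A) (e1 : space1 A) :
  exponential_with theta I -> couple_functional 1 f ->
  emb (space0 A) e0 = emb (space1 A) e1 -> f (emb (space0 A) e0) = 1 ->
  exists2 C : R, 0 < C &
    forall (x0 : space0 A) (x1 : space1 A),
      emb (space0 A) x0 = emb (space1 A) x1 ->
      exists2 y : I A, emb (I A) y = emb (space0 A) x0 &
        rnorm y <= C * (rnorm x0 `^ (1 - theta) * rnorm x1 `^ theta).
Proof.
move=> [/andP[t0 t1] [c c0 cI]] [fl f0 f1] e01 fe.
have inI (x0 : space0 A) (x1 : space1 A) :
    emb (space0 A) x0 = emb (space1 A) x1 ->
    exists y : I A, emb (I A) y = emb (space0 A) x0.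
  move=> x01; have : carrier (I A) (emb (space0 A) x0).
    by apply: inter_sub; split; [exists x0|exists x1].
  by case=> y _ <-; exists y.
have {}f0 z : rnorm (f (emb (space0 A) z)) <= rnorm z by have := f0 z; rewrite mul1r.
have {}f1 z : rnorm (f (emb (space1 A) z)) <= rnorm z by have := f1 z; rewrite mul1r.
(* [g] only depends on the couple; its norm enters the constant [C] *)
have [g ge] := inI _ _ e01.
pose G := rnorm g + 1; have G0 : 0 < G by rewrite ltr_wpDl ?rnorm_ge0.
exists (G * c); first by rewrite mulr_gt0.
move=> x0 x1 x01; have [y yx] := inI _ _ x01; exists y => //.
pose T (v : ambient A) : ambient A := f v *: emb (space0 A) x0.
have T0 := rank_one_opnorm x0 f0; have T1 := rank_one_opnorm x1 f1.
rewrite -x01 -/T in T0 T1.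
have Tc : couple_map (A := A) (B := A) T.
  split.
  - by move=> a u v _ _; rewrite /T fl scalerDl scalerA.
  - exact: rank_one_bounded.
  - by rewrite /T x01; exact: rank_one_bounded.
have Ty : ((rnorm y / G)%:E <= opnorm T (I A) (I A))%E.
  apply: ereal_sup_ubound.
  exists (of_real k G^-1 *: g), (of_real k G^-1 *: y).
  have rG : rnorm (of_real k G^-1 : K^o) = G^-1.
    by rewrite rnorm_of_real ger0_norm// invr_ge0 ltW.
  rewrite !rnormZ rG; split.
  - by rewrite ler_pdivrMl// mulr1 lerDl.
  - rewrite !linearZ/= ge yx /T -[_ *: emb _ e0]addr0 fl.
    have -> : f 0 = 0 by have := fl (-1) 0 0; rewrite scaler0 addr0 scaleN1r addNr.
    by rewrite fe addr0; congr (_ *: _); rewrite -[RHS]mulr1.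
  - by rewrite mulrC.
have pow (v : \bar R) (w r : R) : 0 < r ->
    (0 <= v <= w%:E)%E -> (poweR v r <= (w `^ r)%:E)%E.
  move=> r0 /andP[v0 vw]; rewrite -poweR_EFin.
  apply: gt0_ler_poweR => //; first exact: ltW.
    by rewrite in_itv/= v0 leey.
  by rewrite in_itv/= leey andbT (le_trans v0).
rewrite -mulrA -ler_pdivrMl// mulrC -lee_fin (le_trans Ty)//.
rewrite (le_trans (cI A A T Tc))// !EFinM muleA.
by rewrite !lee_pmul ?mule_ge0 ?poweR_ge0 ?lee_fin ?(ltW c0)//;
  apply: pow; rewrite ?subr_gt0.
Qed.

End Interpolation.

(** * Sums over subsets of the coordinates *)

Section PartialSums.
Variables (R : realType) (k : scalar_kind).
Local Notation K := (scalar_field R k).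
Local Notation L := (l1_space R k).

Lemma lim_unique (V : normedModType K) (u : nat -> V) (l l' : V) :
  u n @[n --> \oo] --> l -> u n @[n --> \oo] --> l' -> l = l'.
Proof. exact: cvg_unique (@norm_hausdorff _ V) _ _ _ _. Qed.

Lemma scalar_seq_complete : seq_complete (K^o : normedModType K).
Proof. by move=> u; exact: scalar_cauchy_cvg. Qed.

(** This is the pairing of [z] with the indicator of [P]: the only bounded
    functionals on l1 that the quotient map onto c0 needs. *)
Definition subsum (P : pred nat) (z : L) : K^o :=
  limn (fun n => \sum_(i < n) (if P i then z i else 0) : K^o).

Lemma subsum_cvg (P : pred nat) (z : L) :
  (\sum_(i < n) (if P i then z i else 0) : K^o) @[n --> \oo] --> subsum P z.
Proof.
have [i|n|l ul _] := @abs_summable _ _ (K^o : normedModType K)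
    (fun i => if P i then z i else 0) (fun i => rnorm (z i)) (rnorm z)
    scalar_seq_complete.
- by case: ifP => _ //; rewrite rnorm0 rnorm_ge0.
- by rewrite rnorm_l1 l1_sum_le.
- by rewrite /subsum (cvg_lim _ ul).
Qed.

Lemma subsum_linear P : linear (subsum P).
Proof.
move=> a y z.
apply: lim_unique (@subsum_cvg P (a *: y + z)) _.
pose S (v : L) n : K^o := \sum_(i < n) (if P i then v i else 0).
rewrite -/(S (a *: y + z)) (_ : S (a *: y + z) = (a \*: S y) + S z).
  by apply: cvgD; [apply: cvgZl_tmp|]; exact: subsum_cvg.
apply/funext => n; rewrite /S !fctE /= scaler_sumr -big_split/=.
by apply: eq_bigr => i _; case: ifP => // _; rewrite scaler0 addr0.
Qed.

(** The first [N] coordinates do not contribute.  This quantitative form gives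
    both the bound of [subsum] and its decay as [P] moves to infinity. *)
Lemma subsum_tail (P : pred nat) N z : (forall i, P i -> (N <= i)%N) ->
  rnorm (subsum P z) <= rnorm z - \sum_(i < N) rnorm (z i).
Proof.
move=> PN; apply: rnorm_lim_le (@subsum_cvg P z) _.
near=> n; rewrite lerBrDr [rnorm z]rnorm_l1 (le_trans _ (l1_sum_le z n))//.
have Nn : (N <= n)%N by near: n; exact: nbhs_infty_ge.
rewrite -!(big_mkord xpredT (fun i => rnorm (z i))).
rewrite (@big_cat_nat _ _ _ N 0 n)//= [leRHS]addrC lerD2r.
rewrite -(big_mkord xpredT (fun i => if P i then z i else 0)).
rewrite (@big_cat_nat _ _ _ N 0 n)//= big_nat big1 ?add0r => [|i iN]; last first.
  by case: ifP => // /PN; lia.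
rewrite (le_trans (rnorm_sum _ _ _))// ler_sum// => i _.
by case: ifP => // _; rewrite rnorm0 rnorm_ge0.
Unshelve. all: by end_near. Qed.

Lemma subsum_le P z : rnorm (subsum P z) <= rnorm z.
Proof. by have := @subsum_tail P 0 z (fun=> ltac:(done)); rewrite big_ord0 subr0. Qed.

Lemma subsum_single (P : pred nat) (j : nat) (z : L) :
  (forall i, i != j -> P i -> z i = 0) ->
  subsum P z = if P j then z j else 0.
Proof.
move=> Pz; apply: lim_unique (@subsum_cvg P z) _.
apply: cvg_near_cst; near=> n.
have jn : (j < n)%N by near: n; exact: nbhs_infty_gt.
rewrite (bigD1 (Ordinal jn))//= big1 ?addr0// => i ij.
by case: ifP => // Pi; exact: Pz.
Unshelve. all: by end_near. Qed.

Lemma l1_tail_small (z : L) (e : R) : 0 < e ->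
  exists N, rnorm z - \sum_(i < N) rnorm (z i) <= e.
Proof.
move=> e0; apply/not_existsP => h.
suff : l1_rnorm z <= l1_rnorm z - e by lra.
apply/l1_rnorm_leP => n; have := h n; rewrite rnorm_l1 => /negP.
by rewrite -ltNge; lra.
Qed.

Lemma unit_sum_le j n :
  \sum_(i < n) rnorm ((i == j :> nat)%:R : K^o) <= 1.
Proof.
have [jn|nj] := ltnP j n; last first.
  rewrite big1 ?ler01// => i _; rewrite (_ : val i == j = false) ?rnorm0//.
  by apply/negbTE; rewrite neq_ltn (leq_trans (ltn_ord i) nj).
rewrite (bigD1 (Ordinal jn))//= eqxx rnorm1 big1 ?addr0// => i ij.
by rewrite (_ : val i == j = false) ?rnorm0//; exact: negbTE.
Qed.

Lemma unit_l1_pred j : (fun i => (i == j)%:R : K^o) \in @l1_pred R k.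
Proof. by rewrite inE; apply/l1_seqP; exists 1 => n; exact: unit_sum_le. Qed.

Definition unit_vec j : L := L1Space (unit_l1_pred j).

Lemma rnorm_unit_vec j : rnorm (unit_vec j) <= 1.
Proof. by rewrite rnorm_l1; apply/l1_rnorm_leP => n; exact: unit_sum_le. Qed.

Lemma subsum_unit P j : subsum P (unit_vec j) = (P j)%:R.
Proof.
rewrite (@subsum_single _ j) => [|i ij _] /=; first by rewrite eqxx; case: (P j).
by rewrite (negbTE ij).
Qed.

End PartialSums.

(** * Bounded sequences inside l1 *)

Section Damping.
Variables (R : realType) (k : scalar_kind).
Local Notation K := (scalar_field R k).
Local Notation L := (l1_space R k).

Definition bounded_by (M : R) (u : nat -> K^o) := forall n, rnorm (u n) <= M.

(** The ambient space of the couple can be any Hausdorff space in which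
    coordinates are continuous.  Weighting bounded sequences by powers of one
    half places them in l1, so that l1 itself provides this space.  The junk
    value on sequences that stay outside l1 is never met, since [damp] is only
    applied to bounded sequences. *)
Definition damp (u : nat -> K^o) : L :=
  insubd (0 : L) (fun n => of_real k (2^-1 ^+ n) * u n : K^o).

Definition undamp (n : nat) (y : L) : K^o := of_real k (2 ^+ n) * y n.

Lemma rnorm_half n : rnorm (of_real k (2^-1 ^+ n) : K^o) = 2^-1 ^+ n :> R.
Proof. by rewrite rnorm_of_real ger0_norm// exprn_ge0// invr_ge0. Qed.

Lemma sum_half_le n : \sum_(i < n) 2^-1 ^+ i <= 2 :> R.
Proof.
have := subrX1 (2^-1 : R) n => /(congr1 (fun x => - 2 * x)).
rewrite mulrA (_ : - 2 * (2^-1 - 1) = 1 :> R) ?mul1r => [<-|]; last by field.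
have : 0 <= 2^-1 ^+ n :> R by rewrite exprn_ge0// invr_ge0.
lra.
Qed.

Lemma damp_sum_le M u n : bounded_by M u ->
  \sum_(i < n) rnorm (of_real k (2^-1 ^+ i) * u i : K^o) <= 2 * M.
Proof.
move=> uM; apply: (@le_trans _ _ (\sum_(i < n) 2^-1 ^+ i * M)).
  by apply: ler_sum => i _; rewrite rnormM rnorm_half ler_wpM2l.
rewrite -mulr_suml ler_wpM2r ?sum_half_le// (le_trans _ (uM 0))//.
exact: rnorm_ge0.
Qed.

Lemma dampE M u n : bounded_by M u -> damp u n = of_real k (2^-1 ^+ n) * u n.
Proof.
move=> uM; rewrite /damp [LHS](_ : _ = (val (insubd (0 : L)
  (fun n => of_real k (2^-1 ^+ n) * u n : K^o))) n)// val_insubd ifT// inE.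
by apply/l1_seqP; exists (2 * M) => m; exact: damp_sum_le.
Qed.

Lemma rnorm_damp M u : bounded_by M u -> rnorm (damp u) <= 2 * M.
Proof.
move=> uM; rewrite rnorm_l1; apply/l1_rnorm_leP => n.
rewrite (eq_bigr (fun i : 'I_n => rnorm (of_real k (2^-1 ^+ i) * u i : K^o))).
  exact: damp_sum_le.
by move=> i _; rewrite (dampE _ uM).
Qed.

Lemma dampK M u n : bounded_by M u -> undamp n (damp u) = u n.
Proof.
move=> uM; rewrite /undamp (dampE _ uM) mulrA -of_realM -exprMn divff//.
by rewrite expr1n of_real1 mul1r.
Qed.

Lemma undamp_linear n : linear (undamp n).
Proof.
move=> a y z; rewrite /undamp.
rewrite [LHS](_ : _ = of_real k (2 ^+ n) * (a * y n + z n))//.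
by rewrite mulrDr mulrCA.
Qed.

Lemma undamp_ext (y z : L) : (forall n, undamp n y = undamp n z) -> y = z.
Proof.
move=> yz; apply: l1_ext => n.
have /(congr1 (fun x => of_real k (2^-1 ^+ n) * x)) := yz n.
by rewrite /undamp !mulrA -of_realM -exprMn mulVf// expr1n of_real1 !mul1r.
Qed.

Lemma damp_linear M N a u v : bounded_by M u -> bounded_by N v ->
  damp (a *: u + v) = a *: damp u + damp v.
Proof.
move=> uM vN; apply: undamp_ext => n; rewrite undamp_linear.
rewrite (dampK _ uM) (dampK _ vN) (@dampK (rnorm (a : K^o) * M + N))// => m.
rewrite (le_trans (rnormD _ _))// lerD//.
by rewrite (rnormZ (V := K^o)) ler_wpM2l// rnorm_ge0.
Qed.

(** The factor 2 accommodates coordinates that add two entries of [z]. *)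
Definition dominated (phi : L -> nat -> K^o) :=
  linear phi /\ forall z, bounded_by (2 * rnorm z) (phi z).

Lemma damp_dominated_linear phi : dominated phi -> linear (damp \o phi).
Proof.
by move=> [phil phib] a y z; rewrite /= phil (damp_linear _ (phib y) (phib z)).
Qed.

Lemma undamp_dominated phi n z : dominated phi -> undamp n (damp (phi z)) = phi z n.
Proof. by move=> [_ phib]; rewrite (dampK _ (phib z)). Qed.

Lemma damp_dominated_continuous phi : dominated phi -> continuous (damp \o phi).
Proof.
move=> phid; have dl := damp_dominated_linear phid.
pose f : {linear L -> L} := HB.pack (damp \o phi) (GRing.isLinear.Build _ _ _ _ _ dl).
apply: (@bounded_linear_cont _ _ _ _ f 4) => z.
have [_ phib] := phid; rewrite (le_trans (rnorm_damp (phib z)))//.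
by rewrite mulrA -natrM.
Qed.

End Damping.
Arguments damp {R k} u.

(** * Finite sets of natural numbers as binary expansions *)

Section Bits.
Definition bit (d n : nat) : bool := odd (iter n half d).

Lemma bit_support d n : bit d n -> (n < d)%N.
Proof.
rewrite /bit; elim: n d => [|n IH] d /=; first by case: d.
by rewrite -iterS iterSr => /IH; lia.
Qed.

(** Binary expansions, built from the lowest bit. *)
Lemma bits_of_pred (P : pred nat) N : (forall n, P n -> (n < N)%N) ->
  exists d, bit d =1 P.
Proof.
elim: N P => [|N IH] P PN.
  exists 0 => n; rewrite /bit; case: (P n) (PN n) => [/(_ isT)//|_].
  by have -> : iter n half 0 = 0%N by elim: n => //= m ->.
have [d dP] := IH (fun n => P n.+1) (fun n Pn => PN n.+1 Pn).
exists (P 0 + d.*2)%N => -[|n].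
  by rewrite /bit/= oddD odd_double addbF; case: (P 0).
by rewrite /bit iterSr half_bit_double -dP.
Qed.

End Bits.

(** * The couple *)

Section Couple.
Variables (R : realType) (k : scalar_kind).
Local Notation K := (scalar_field R k).
Local Notation L := (l1_space R k).

(** Any sequence such that every positive power of it beats the linear growth
    of the sizes of the sets would do. *)
Definition eps (d : nat) : R := expR (- d%:R).

Lemma eps_gt0 d : 0 < eps d. Proof. exact: expR_gt0. Qed.

Lemma eps_le1 d : eps d <= 1.
Proof. by rewrite /eps -expR0 ler_expR lerNl oppr0. Qed.

Lemma rnorm_eps d : rnorm (of_real k (eps d) : K^o) = eps d.
Proof. by rewrite rnorm_of_real ger0_norm// ltW// eps_gt0. Qed.

(** The quotient map of l1 onto c0 as a zero-one matrix.  Entries of l1 come in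
    three families: the entry [3 * n] goes to the unit vector [e_n], the entry
    [3 * d + 1] to the indicator of the set coded by [d], and the entry
    [3 * d + 2] to zero. *)
Definition incidence (n : nat) : pred nat := fun j =>
  if (j %% 3 == 0)%N then (j %/ 3 == n)%N else ((j %% 3 == 1)%N && bit (j %/ 3) n).

Lemma incidence_x n m : incidence n (3 * m)%N = (m == n).
Proof. by rewrite /incidence modnMr mulKn. Qed.

Lemma incidence_u n d : incidence n (3 * d + 1)%N = bit d n.
Proof.
rewrite /incidence.
have -> : ((3 * d + 1) %% 3 = 1)%N by lia.
by have -> : ((3 * d + 1) %/ 3 = d)%N by lia.
Qed.

Lemma incidence_v n d : incidence n (3 * d + 2)%N = false.
Proof. by rewrite /incidence; have -> : ((3 * d + 2) %% 3 = 2)%N by lia. Qed.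

Lemma incidence_support n j : incidence n j -> (n <= j)%N.
Proof.
rewrite /incidence; case: ifP => _ => [/eqP <-|/andP[_ /bit_support]];
  first exact: leq_div.
by move=> /ltnW /leq_trans; apply; exact: leq_div.
Qed.

Definition qcoord (z : L) (n : nat) : K^o := subsum (incidence n) z.
Definition ucoord (z : L) (d : nat) : K^o := of_real k (eps d) * z (3 * d + 1)%N.
Definition vcoord (z : L) (d : nat) : K^o := ucoord z d + z (3 * d + 2)%N.

Lemma qcoord_le z n : rnorm (qcoord z n) <= rnorm z.
Proof. exact: subsum_le. Qed.

Lemma coord_le (z : L) n : rnorm (z n) <= rnorm z.
Proof. by rewrite [leRHS]rnorm_l1 l1_coord_le. Qed.

Lemma ucoord_le z d : rnorm (ucoord z d) <= rnorm z.
Proof.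
rewrite /ucoord rnormM rnorm_eps -[leRHS]mul1r.
by rewrite ler_pM ?rnorm_ge0 ?eps_le1 ?coord_le// ltW// eps_gt0.
Qed.

Lemma vcoord_le z d : rnorm (vcoord z d) <= 2 * rnorm z.
Proof.
by rewrite (le_trans (rnormD _ _))// mulr_natl mulr2n lerD ?ucoord_le ?coord_le.
Qed.

Lemma qcoord_dominated : dominated qcoord.
Proof.
split=> [a y z|z n]; first by apply/funext => n; exact: subsum_linear.
by rewrite (le_trans (qcoord_le z n))// ler_peMl ?rnorm_ge0// ler1n.
Qed.

Lemma ucoord_dominated : dominated ucoord.
Proof.
split=> [a y z|z n]; last first.
  by rewrite (le_trans (ucoord_le z n))// ler_peMl ?rnorm_ge0// ler1n.
apply/funext => d; rewrite /ucoord.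
rewrite [LHS](_ : _ = of_real k (eps d) *
  (a * y (3 * d + 1)%N + z (3 * d + 1)%N))//.
by rewrite mulrDr mulrCA.
Qed.

Lemma vcoord_dominated : dominated vcoord.
Proof.
split=> [a y z|z n]; last exact: vcoord_le.
have [ul _] := ucoord_dominated.
apply/funext => n; rewrite /vcoord ul fctE [in RHS]/=.
rewrite [RHS](_ : _ = a *: (ucoord y n + y (3 * n + 2)%N) +
  (ucoord z n + z (3 * n + 2)%N))//.
by rewrite scalerDr addrACA.
Qed.

(** Row [n] of the matrix vanishes at the entries before [n], so the [n]-th
    value is bounded by a tail of the norm of [z]. *)
Lemma qcoord_c0 z : c0_seq (qcoord z).
Proof.
apply/cvg_rnormP => e e0; have [N zN] := l1_tail_small z e0.
near=> n; rewrite sub0r rnormN (le_trans _ zN)// subsum_tail// => i /incidence_support.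
by apply: leq_trans; near: n; exact: nbhs_infty_ge.
Unshelve. all: by end_near. Qed.

(** The entries [3 * d + 1] are read in [ucoord], then the entries [3 * d + 2]
    in [vcoord]; what remains of [qcoord] is the entry [3 * n]. *)
Lemma coords_inj (y z : L) : qcoord y = qcoord z -> ucoord y = ucoord z ->
  vcoord y = vcoord z -> y = z.
Proof.
move=> qyz uyz vyz.
have yu d : y (3 * d + 1)%N = z (3 * d + 1)%N.
  move/(congr1 (fun f => f d)): uyz; apply: mulfI.
  by rewrite gt_eqF// -(of_real0 R k) of_real_lt eps_gt0.
have yv d : y (3 * d + 2)%N = z (3 * d + 2)%N.
  by move/(congr1 (fun f => f d)): vyz; rewrite /vcoord uyz; exact: addrI.
have yx n : y (3 * n)%N = z (3 * n)%N.
  apply/eqP; rewrite -subr_eq0.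
  have <- : subsum (incidence n) (y - z) = 0.
    rewrite addrC -scaleN1r subsum_linear -/(qcoord y n) qyz.
    by rewrite scaleN1r addNr.
  rewrite (@subsum_single _ _ _ (3 * n)) ?incidence_x ?eqxx// => j jn.
  rewrite /incidence; case: ifPn => [/eqP j3 /eqP jd|_ /andP[/eqP j1 _]].
    by move: jn; rewrite (divn_eq j 3) j3 jd addn0 mulnC eqxx.
  rewrite (divn_eq j 3) j1 mulnC.
  rewrite [LHS](_ : _ = y (3 * (j %/ 3) + 1)%N - z (3 * (j %/ 3) + 1)%N)//.
  by rewrite yu subrr.
apply: l1_ext => j; rewrite (divn_eq j 3) mulnC.
have : (j %% 3 < 3)%N by rewrite ltn_mod.
by case: (j %% 3)%N => [|[|[|]]]//; rewrite ?addn0.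
Qed.


Definition triple (f g h : L -> nat -> K^o) (z : L) : L * L * L :=
  ((damp \o f) z, (damp \o g) z, (damp \o h) z).

Lemma triple_linear f g h :
  dominated f -> dominated g -> dominated h -> linear (triple f g h).
Proof.
move=> fd gd hd a y z; rewrite /triple (damp_dominated_linear fd).
by rewrite (damp_dominated_linear gd) (damp_dominated_linear hd).
Qed.

Lemma triple_continuous f g h :
  dominated f -> dominated g -> dominated h -> continuous (triple f g h).
Proof.
move=> fd gd hd z.
have [fc gc hc] : [/\ continuous (damp \o f : L -> L), continuous (damp \o g : L -> L)
    & continuous (damp \o h : L -> L)].
  by split; exact: damp_dominated_continuous.
exact: (cvg_pair (cvg_pair (fc z) (gc z)) (hc z)).
Qed.

(** The two embeddings differ only by the order of the last two slots.  An
    entry [3 * d + 1] contributes equally to both slots, while an entry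
    [3 * d + 2] contributes to the third slot for the first embedding and to
    the second slot for the second one. *)
Definition embed0 : L -> L * L * L := triple qcoord ucoord vcoord.
Definition embed1 : L -> L * L * L := triple qcoord vcoord ucoord.

Lemma embed0_linear : linear embed0.
Proof.
exact: triple_linear qcoord_dominated ucoord_dominated vcoord_dominated.
Qed.

Lemma embed1_linear : linear embed1.
Proof.
exact: triple_linear qcoord_dominated vcoord_dominated ucoord_dominated.
Qed.

Lemma damp_dominated_inj phi (y z : L) : dominated phi ->
  damp (phi y) = damp (phi z) -> phi y = phi z.
Proof.
move=> phid yz; apply/funext => n.
by rewrite -(undamp_dominated n y phid) yz undamp_dominated.
Qed.

Lemma embed0_inj : injective embed0.
Proof.
move=> y z [/(damp_dominated_inj qcoord_dominated) qyz
  /(damp_dominated_inj ucoord_dominated) uyz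
  /(damp_dominated_inj vcoord_dominated) vyz].
exact: coords_inj.
Qed.

Lemma embed1_inj : injective embed1.
Proof.
move=> y z [/(damp_dominated_inj qcoord_dominated) qyz
  /(damp_dominated_inj vcoord_dominated) vyz
  /(damp_dominated_inj ucoord_dominated) uyz].
exact: coords_inj.
Qed.

HB.instance Definition _ := GRing.isLinear.Build _ _ _ _ _ embed0_linear.
HB.instance Definition _ := GRing.isLinear.Build _ _ _ _ _ embed1_linear.

Lemma embed0_continuous : continuous embed0.
Proof.
exact: triple_continuous qcoord_dominated ucoord_dominated vcoord_dominated.
Qed.

Lemma embed1_continuous : continuous embed1.
Proof.
exact: triple_continuous qcoord_dominated vcoord_dominated ucoord_dominated.
Qed.

Definition ambient_space : topologicalLmodType K := (L * L * L)%type.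

Lemma ambient_space_hausdorff : hausdorff_space ambient_space.
Proof. exact: norm_hausdorff. Qed.

Definition l1_couple : banach_couple R k :=
  @BanachCouple R k ambient_space ambient_space_hausdorff
    (@BanachIn R k ambient_space L embed0 embed0_inj)
    (@BanachIn R k ambient_space L embed1 embed1_inj)
    embed0_continuous embed1_continuous.

End Couple.

(** * Vectors of the intersection *)

Section Vectors.
Variables (R : realType) (k : scalar_kind).
Local Notation K := (scalar_field R k).
Local Notation L := (l1_space R k).
Local Notation E := (ambient_space R k).

Definition slot_q n (y : E) : K^o := undamp n y.1.1.
Definition slot_u n (y : E) : K^o := undamp n y.1.2.
Definition slot_v n (y : E) : K^o := undamp n y.2.

Lemma slot_q_linear n : linear (slot_q n).
Proof. by move=> a y z; exact: undamp_linear. Qed.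
Lemma slot_u_linear n : linear (slot_u n).
Proof. by move=> a y z; exact: undamp_linear. Qed.
Lemma slot_v_linear n : linear (slot_v n).
Proof. by move=> a y z; exact: undamp_linear. Qed.

HB.instance Definition _ n := GRing.isLinear.Build _ _ _ _ _ (slot_q_linear n).
HB.instance Definition _ n := GRing.isLinear.Build _ _ _ _ _ (slot_u_linear n).
HB.instance Definition _ n := GRing.isLinear.Build _ _ _ _ _ (slot_v_linear n).

Lemma slot_qBB n (x y z : E) :
  slot_q n (x - y - z) = slot_q n x - slot_q n y - slot_q n z.
Proof. by rewrite !linearB. Qed.

Lemma slot_uBB n (x y z : E) :
  slot_u n (x - y - z) = slot_u n x - slot_u n y - slot_u n z.
Proof. by rewrite !linearB. Qed.

Lemma slot_vBB n (x y z : E) :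
  slot_v n (x - y - z) = slot_v n x - slot_v n y - slot_v n z.
Proof. by rewrite !linearB. Qed.

Lemma slots_ext (y z : E) : (forall n, slot_q n y = slot_q n z) ->
  (forall n, slot_u n y = slot_u n z) -> (forall n, slot_v n y = slot_v n z) ->
  y = z.
Proof.
case: y z => [[y1 y2] y3] [[z1 z2] z3] q u v.
by congr (_, _, _); apply: undamp_ext; [exact: q|exact: u|exact: v].
Qed.

Lemma slot_q0 n z : slot_q n (embed0 z) = qcoord z n.
Proof. exact: undamp_dominated (@qcoord_dominated R k). Qed.
Lemma slot_u0 n z : slot_u n (embed0 z) = ucoord z n.
Proof. exact: undamp_dominated (@ucoord_dominated R k). Qed.
Lemma slot_v0 n z : slot_v n (embed0 z) = vcoord z n.
Proof. exact: undamp_dominated (@vcoord_dominated R k). Qed.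
Lemma slot_q1 n z : slot_q n (embed1 z) = qcoord z n.
Proof. exact: undamp_dominated (@qcoord_dominated R k). Qed.
Lemma slot_u1 n z : slot_u n (embed1 z) = vcoord z n.
Proof. exact: undamp_dominated (@vcoord_dominated R k). Qed.
Lemma slot_v1 n z : slot_v n (embed1 z) = ucoord z n.
Proof. exact: undamp_dominated (@ucoord_dominated R k). Qed.

Definition slotE := (slot_q0, slot_u0, slot_v0, slot_q1, slot_u1, slot_v1).

Lemma slot_q_functional n :
  couple_functional (A := l1_couple R k) 1 (slot_q n).
Proof.
split=> [|z|z]; first exact: slot_q_linear.
- by rewrite mul1r [emb _ _]/(embed0 z) slotE qcoord_le.
- by rewrite mul1r [emb _ _]/(embed1 z) slotE qcoord_le.
Qed.

Lemma slot_u_functional n :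
  couple_functional (A := l1_couple R k) 2 (slot_u n).
Proof.
split=> [|z|z]; first exact: slot_u_linear.
- rewrite [emb _ _]/(embed0 z) slotE (le_trans (ucoord_le z n))//.
  by rewrite ler_peMl ?rnorm_ge0// ler1n.
- by rewrite [emb _ _]/(embed1 z) slotE vcoord_le.
Qed.

Lemma slot_v_functional n :
  couple_functional (A := l1_couple R k) 2 (slot_v n).
Proof.
split=> [|z|z]; first exact: slot_v_linear.
- by rewrite [emb _ _]/(embed0 z) slotE vcoord_le.
- rewrite [emb _ _]/(embed1 z) slotE (le_trans (ucoord_le z n))//.
  by rewrite ler_peMl ?rnorm_ge0// ler1n.
Qed.

Definition lift_q (a : nat -> K^o) : E := (damp a, 0, 0).

Section Lift.
Variables (M : R) (a : nat -> K^o).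
Hypothesis aM : bounded_by M a.

Lemma slot_q_lift n : slot_q n (lift_q a) = a n.
Proof. exact: dampK aM. Qed.

Lemma slot_u_lift n : slot_u n (lift_q a) = 0.
Proof. by rewrite /slot_u /undamp mulr0. Qed.

Lemma slot_v_lift n : slot_v n (lift_q a) = 0.
Proof. by rewrite /slot_v /undamp mulr0. Qed.

End Lift.

Lemma qcoord_linear n : linear (fun z : L => qcoord z n).
Proof. exact: subsum_linear. Qed.

Lemma coord_linear j : linear (fun z : L => z j : K^o).
Proof. by []. Qed.

Lemma linear_comb (f : L -> K^o) n (c : 'I_n -> K) (v : 'I_n -> L) :
  linear f -> f (\sum_i c i *: v i) = \sum_i c i * f (v i).
Proof.
move=> fl; pose g : {linear L -> K^o} := HB.pack f (GRing.isLinear.Build _ _ _ _ _ fl).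
by rewrite -[f]/(g : L -> K^o) linear_sum; apply: eq_bigr => i _; rewrite linearZ.
Qed.

Lemma qcoord_unit j n : qcoord (unit_vec R k j) n = (incidence n j)%:R.
Proof. exact: subsum_unit. Qed.

(** [small_rep d] in either space of the couple and [large_rep d] in the other
    one represent the same vector of the intersection.  Its only nonzero entry
    is [eps d], in the third slot when [small_rep d] is taken in the first
    space and in the second slot when it is taken in the second space. *)
Definition small_rep (d : nat) : L := of_real k (eps R d) *: unit_vec R k (3 * d + 2)%N.

Definition large_rep (d : nat) : L :=
  unit_vec R k (3 * d + 1)%N - small_rep d
  - \sum_(n < d) ((bit d n)%:R : K) *: unit_vec R k (3 * n)%N.

Lemma rnorm_small_rep d : rnorm (small_rep d) <= eps R d.
Proof.
by rewrite rnormZ rnorm_eps ler_piMr ?rnorm_unit_vec// ltW// eps_gt0.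
Qed.

(** The set coded by [d] has at most [d] elements. *)
Lemma rnorm_large_rep d : rnorm (large_rep d) <= d%:R + 2.
Proof.
have s1 : rnorm (\sum_(n < d) ((bit d n)%:R : K) *: unit_vec R k (3 * n)%N) <= d%:R.
  rewrite (le_trans (rnorm_sum _ _ _))// (_ : d%:R = \sum_(n < d) 1); last first.
    by rewrite sumr_const card_ord.
  apply: ler_sum => n _; rewrite rnormZ.
  case: (bit d n); last by rewrite rnorm0 mul0r.
  by rewrite rnorm1 mul1r rnorm_unit_vec.
have s2 : rnorm (unit_vec R k (3 * d + 1)%N - small_rep d) <= 1 + 1.
  apply: le_trans (rnormB _ _) _; apply: lerD (rnorm_unit_vec _ _ _) _.
  exact: le_trans (rnorm_small_rep d) (eps_le1 _ _).
apply: le_trans (rnormB _ _) _; rewrite [leRHS]addrC; exact: lerD s2 s1.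
Qed.

Lemma qcoordB (y z : L) n : qcoord (y - z) n = qcoord y n - qcoord z n.
Proof. by rewrite addrC -scaleN1r qcoord_linear scaleN1r addrC. Qed.

Lemma qcoordZ a (z : L) n : qcoord (a *: z) n = a * qcoord z n.
Proof.
have q0 : qcoord (0 : L) n = 0 by rewrite -(subrr (0 : L)) qcoordB subrr.
by rewrite -[a *: z]addr0 qcoord_linear q0 addr0.
Qed.

Lemma small_coord d j :
  small_rep d j = of_real k (eps R d) * (j == 3 * d + 2)%N%:R :> K.
Proof. by []. Qed.

Lemma large_coord d j : large_rep d j =
  (j == 3 * d + 1)%N%:R - of_real k (eps R d) * (j == 3 * d + 2)%N%:R
  - \sum_(n < d) (bit d n)%:R * (j == 3 * n)%N%:R :> K.
Proof.
by rewrite -(linear_comb (fun n : 'I_d => (bit d n)%:R)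
  (fun n => unit_vec R k (3 * n)%N) (coord_linear j)).
Qed.

Lemma small_qcoord d n : qcoord (small_rep d) n = 0.
Proof. by rewrite qcoordZ qcoord_unit incidence_v mulr0. Qed.

Lemma small_ucoord d n : ucoord (small_rep d) n = 0.
Proof.
rewrite /ucoord small_coord (_ : (_ == _)%N = false) ?mulr0//.
by apply/negbTE; lia.
Qed.

Lemma small_vcoord d n :
  vcoord (small_rep d) n = of_real k (eps R d) * (n == d)%:R.
Proof.
rewrite /vcoord small_ucoord add0r small_coord; congr (_ * (nat_of_bool _)%:R).
by apply/eqP/eqP; lia.
Qed.

Lemma large_qcoord d n : qcoord (large_rep d) n = 0.
Proof.
rewrite !qcoordB small_qcoord subr0 qcoord_unit incidence_u.
rewrite (linear_comb _ _ (qcoord_linear n)); apply/eqP; rewrite subr_eq0; apply/eqP.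
under eq_bigr do rewrite qcoord_unit incidence_x.
have [nd|dn] := ltnP n d; last first.
  rewrite (contraNF (@bit_support d n)) -?leqNgt// big1// => m _.
  by rewrite ltn_eqF ?mulr0// (leq_trans (ltn_ord m)).
rewrite (bigD1 (Ordinal nd))//= eqxx mulr1 big1 ?addr0// => m mn.
by rewrite (_ : (val m == n) = false) ?mulr0//; exact: negbTE.
Qed.

Lemma large_sum0 d j : (j %% 3 != 0)%N ->
  \sum_(n < d) (bit d n)%:R * (j == 3 * n)%N%:R = 0 :> K.
Proof.
move=> j3; rewrite big1// => n _; rewrite (_ : (_ == _) = false) ?mulr0//.
by apply/eqP => jn; move: j3; rewrite jn modnMr.
Qed.

Lemma large_ucoord d n :
  ucoord (large_rep d) n = of_real k (eps R d) * (n == d)%:R.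
Proof.
rewrite /ucoord large_coord large_sum0 ?subr0; last by lia.
rewrite (_ : (3 * n + 1 == 3 * d + 2)%N = false) ?mulr0 ?subr0; last first.
  by apply/negbTE; lia.
rewrite (_ : (3 * n + 1 == 3 * d + 1)%N = (n == d)); last by apply/eqP/eqP; lia.
by case: eqP => [->//|_]; rewrite !mulr0.
Qed.

Lemma large_vcoord d n : vcoord (large_rep d) n = 0.
Proof.
rewrite /vcoord large_ucoord large_coord large_sum0 ?subr0; last by lia.
rewrite (_ : (3 * n + 2 == 3 * d + 1)%N = false); last by apply/negbTE; lia.
rewrite (_ : (3 * n + 2 == 3 * d + 2)%N = (n == d)); last by apply/eqP/eqP; lia.
by rewrite sub0r subrr.
Qed.

Lemma embed_small_large d : embed0 (small_rep d) = embed1 (large_rep d).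
Proof.
apply: slots_ext => n; rewrite !slotE.
- by rewrite small_qcoord large_qcoord.
- by rewrite small_ucoord large_vcoord.
- by rewrite small_vcoord large_ucoord.
Qed.

Lemma embed_large_small d : embed0 (large_rep d) = embed1 (small_rep d).
Proof.
apply: slots_ext => n; rewrite !slotE.
- by rewrite small_qcoord large_qcoord.
- by rewrite small_vcoord large_ucoord.
- by rewrite small_ucoord large_vcoord.
Qed.


Lemma unit_ucoord d n :
  ucoord (unit_vec R k (3 * d + 1)%N) n = of_real k (eps R d) * (n == d)%:R.
Proof.
rewrite /ucoord /= (_ : (3 * n + 1 == 3 * d + 1)%N = (n == d)).
  by case: eqP => [->//|_]; rewrite !mulr0.
by apply/eqP/eqP; lia.
Qed.

Lemma unit_vcoord d n :
  vcoord (unit_vec R k (3 * d + 1)%N) n = of_real k (eps R d) * (n == d)%:R.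
Proof.
rewrite /vcoord unit_ucoord /= (_ : (3 * n + 2 == 3 * d + 1)%N = false) ?addr0//.
by apply/negbTE; lia.
Qed.

(** The unit vectors of index [3 * d + 1] fill the last two slots equally, so
    they are common to both spaces. *)
Lemma embed_unit d :
  embed0 (unit_vec R k (3 * d + 1)%N) = embed1 (unit_vec R k (3 * d + 1)%N).
Proof. by apply: slots_ext => n; rewrite !slotE// unit_ucoord unit_vcoord. Qed.

Lemma embed_unit_x n :
  embed0 (unit_vec R k (3 * n)%N) = embed1 (unit_vec R k (3 * n)%N).
Proof.
have u0 m : ucoord (unit_vec R k (3 * n)%N) m = 0.
  rewrite /ucoord /= (_ : (3 * m + 1 == 3 * n)%N = false) ?mulr0//.
  by apply/negbTE; lia.
have v0 m : vcoord (unit_vec R k (3 * n)%N) m = 0.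
  rewrite /vcoord u0 add0r /= (_ : (3 * m + 2 == 3 * n)%N = false)//.
  by apply/negbTE; lia.
apply: slots_ext => m; first by rewrite slot_q0 slot_q1.
  by rewrite slot_u0 slot_u1 u0 v0.
by rewrite slot_v0 slot_v1 u0 v0.
Qed.

Definition bits (d n : nat) : K^o := (bit d n)%:R.

Lemma bits_bounded d : bounded_by 1 (bits d).
Proof. by move=> n; rewrite /bits; case: bit; rewrite ?rnorm1 ?rnorm0 ?ler01. Qed.

(** The three terms on the right belong to the intersection and have moderate
    geometric means, although the two norms of the left-hand side are only
    bounded by the size of [d]. *)
Lemma lift_bitsE d : lift_q (bits d) = embed0 (unit_vec R k (3 * d + 1)%N)
  - embed0 (small_rep d) - embed0 (large_rep d).
Proof.
apply: slots_ext => n.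
- rewrite (slot_q_lift (@bits_bounded d)) slot_qBB !slot_q0.
  by rewrite qcoord_unit incidence_u small_qcoord large_qcoord !subr0.
- rewrite slot_u_lift slot_uBB !slot_u0 unit_ucoord.
  by rewrite small_ucoord large_ucoord subr0 subrr.
- rewrite slot_v_lift slot_vBB !slot_v0 unit_vcoord.
  by rewrite small_vcoord large_vcoord subrr subr0.
Qed.

(** The inequality [1 + x <= exp x] at [x = d * s]. *)
Lemma eps_pow_le (s t : R) d : 0 < s <= 1 -> 0 <= t <= 1 ->
  eps R d `^ s * (d%:R + 2) `^ t <= 2 / s.
Proof.
move=> /andP[s0 s1] /andP[t0 t1].
have d0 : 0 <= d%:R :> R by rewrite ler0n.
have d2 : 1 <= d%:R + 2 :> R by lra.
apply: (@le_trans _ _ ((expR (d%:R * s))^-1 * (d%:R + 2))).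
  rewrite ler_pM ?powR_ge0//; first by rewrite /eps -expRM mulNr expRN.
  by rewrite -[leRHS]powRr1 ?(le_trans ler01)// ler_powR.
rewrite mulrC ler_pdivrMr ?expR_gt0//.
apply: (@le_trans _ _ (2 / s * (1 + d%:R * s))); last first.
  by rewrite ler_wpM2l ?expR_ge1Dx// divr_ge0// ltW.
have -> : 2 / s * (1 + d%:R * s) = 2 / s + 2 * d%:R by field; rewrite gt_eqF.
have : 2 <= 2 / s by rewrite ler_pdivlMr// ler_piMr.
lra.
Qed.

End Vectors.

(** * Binary digits of real numbers *)

Section Digits.
Variables (R : realType).

(** The binary expansion algorithm: [remainder x i] is what remains of [x] after
    [i] digits, multiplied by [2 ^+ i]. *)
Fixpoint remainder (x : R) (i : nat) : R :=
  if i is i'.+1 then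
    let r := remainder x i' in if 2^-1 <= r then 2 * r - 1 else 2 * r
  else x.

Definition digit (x : R) (i : nat) : bool := 2^-1 <= remainder x i.

Lemma remainder01 x i : 0 <= x <= 1 -> 0 <= remainder x i <= 1.
Proof.
move=> x01; elim: i => //= i /andP[r0 r1].
by case: (leP 2^-1 (remainder x i)) => h; apply/andP; split; lra.
Qed.

(** At small [x] the early digits vanish; for a null sequence, each digit is
    therefore nonzero at finitely many indices only. *)
Lemma remainder_le x i : 0 <= x <= 1 -> remainder x i <= 2 ^+ i * x.
Proof.
move=> x01; elim: i => [|i IH] /=; first by rewrite expr0 mul1r.
by rewrite exprS -mulrA; case: (leP 2^-1 (remainder x i)) => h; lra.
Qed.

Lemma digits_sum x n :
  x = \sum_(i < n) 2^-1 ^+ i.+1 * (digit x i)%:R + 2^-1 ^+ n * remainder x n.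
Proof.
elim: n => [|n IH]; first by rewrite big_ord0 expr0 mul1r add0r.
rewrite big_ord_recr/= {1}IH -addrA; congr (_ + _).
rewrite /digit exprSr; case: leP => _ /=; rewrite ?mulr1 ?mulr0 ?add0r; by field.
Qed.

End Digits.

(** * Lifting c0 to the intermediate spaces *)

Section Lifting.
Variables (R : realType) (k : scalar_kind).
Local Notation K := (scalar_field R k).
Local Notation A := (l1_couple R k).
Variable I : interpolation_method R k.

(** The geometric mean bound, applied to the three terms of [lift_bitsE].  The
    reference vector common to both spaces is [(e_0, 0, 0)], on which the
    functional [slot_q 0] is one. *)
Lemma bits_in_interp : exponential I -> exists2 C : R, 0 < C &
  forall d, exists2 y : I A, emb (I A) y = lift_q (bits R k d) & rnorm y <= C.
Proof.
move=> [theta thetaI]; have [/andP[t0 t1] _] := thetaI.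
have s1 : 0 < 1 - theta <= 1 by apply/andP; split; lra.
have s2 : 0 <= theta <= 1 by apply/andP; split; lra.
have s3 : 0 < theta <= 1 by apply/andP; split; lra.
have s4 : 0 <= 1 - theta <= 1 by apply/andP; split; lra.
have qc : slot_q 0 (embed0 (unit_vec R k (3 * 0)%N)) = 1.
  by rewrite slot_q0 qcoord_unit incidence_x.
have [C C0 CI] := interp_geometric_mean thetaI (slot_q_functional R k 0)
  (embed_unit_x R k 0) qc.
exists (C * (1 + 2 / (1 - theta) + 2 / theta)).
  by rewrite mulr_gt0// !addr_gt0// divr_gt0// subr_gt0.
move=> d.
have [yu yuE yuC] := CI _ _ (embed_unit R k d).
have [yw ywE ywC] := CI _ _ (embed_small_large R k d).
have [yv yvE yvC] := CI _ _ (embed_large_small R k d).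
exists (yu - yw - yv).
  by rewrite !linearB/= yuE ywE yvE lift_bitsE.
have mono (x y r : R) : 0 <= r -> 0 <= x -> x <= y -> x `^ r <= y `^ r.
  by move=> r0 x0 xy; rewrite ge0_ler_powR// nnegrE// (le_trans x0).
have t1' : 0 <= 1 - theta by rewrite subr_ge0 ltW.
have t0' := ltW t0.
have large0 : 0 <= rnorm (large_rep R k d) by exact: rnorm_ge0.
have small0 : 0 <= rnorm (small_rep R k d) by exact: rnorm_ge0.
have bu : rnorm (unit_vec R k (3 * d + 1)%N) `^ (1 - theta) *
    rnorm (unit_vec R k (3 * d + 1)%N) `^ theta <= 1.
  rewrite -[leRHS]mul1r; apply: ler_pM; rewrite ?powR_ge0//.
    rewrite [leRHS](_ : _ = 1 `^ (1 - theta)); last by rewrite powR1.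
    by apply: mono; rewrite ?rnorm_ge0 ?rnorm_unit_vec.
  rewrite [leRHS](_ : _ = 1 `^ theta); last by rewrite powR1.
    by apply: mono; rewrite ?rnorm_ge0 ?rnorm_unit_vec.
have bw : rnorm (small_rep R k d) `^ (1 - theta) * rnorm (large_rep R k d) `^ theta
    <= 2 / (1 - theta).
  apply: (@le_trans _ _ (eps R d `^ (1 - theta) * (d%:R + 2) `^ theta)).
    apply: (ler_pM (powR_ge0 _ _) (powR_ge0 _ _)).
      exact: mono t1' small0 (rnorm_small_rep R k d).
    exact: mono t0' large0 (rnorm_large_rep R k d).
  exact: eps_pow_le s1 s2.
have bv : rnorm (large_rep R k d) `^ (1 - theta) * rnorm (small_rep R k d) `^ theta
    <= 2 / theta.
  rewrite mulrC; apply: (@le_trans _ _ (eps R d `^ theta * (d%:R + 2) `^ (1 - theta))).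
    apply: (ler_pM (powR_ge0 _ _) (powR_ge0 _ _)).
      exact: mono t0' small0 (rnorm_small_rep R k d).
    exact: mono t1' large0 (rnorm_large_rep R k d).
  exact: eps_pow_le s3 s4.
apply: le_trans (rnormB _ _) _; rewrite mulrDr; apply: lerD; last first.
  by rewrite (le_trans yvC)// ler_wpM2l// ltW.
apply: le_trans (rnormB _ _) _; rewrite mulrDr; apply: lerD.
  by rewrite (le_trans yuC)// ler_wpM2l// ltW.
by rewrite (le_trans ywC)// ler_wpM2l// ltW.
Qed.

End Lifting.

Section Lifting.
Variables (R : realType) (k : scalar_kind).
Local Notation K := (scalar_field R k).
Local Notation A := (l1_couple R k).
Local Notation E := (ambient_space R k).
Variable I : interpolation_method R k.
Local Notation embI := (emb (I A)).

(** Used with the slots to identify the sum of a series in [I A]. *)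
Lemma interp_functional_cvg M (f : E -> K^o) (u : nat -> I A) (l : I A) :
  0 < M -> couple_functional (A := A) M f -> u n @[n --> \oo] --> l ->
  f (embI (u n)) @[n --> \oo] --> (f (embI l) : K^o).
Proof.
move=> M0 fM ul; have [C C0 /(_ M f M0 fM) Cf] := interp_functional_le A I.
have [fl _ _] := fM.
have CM0 : 0 < C * M by rewrite mulr_gt0.
apply/cvg_rnormP => e e0; have /cvg_rnormP/(_ (e / (C * M))) := ul.
rewrite divr_gt0// => /(_ isT); apply: filterS => n ulne.
have -> : f (embI l) - f (embI (u n)) = f (embI (l - u n)).
  by rewrite linearB addrC -scaleN1r -fl scaleN1r addrC.
by rewrite (le_trans (Cf _))// mulrC -ler_pdivlMr.
Qed.

Lemma of_real_sum n (F : 'I_n -> R) :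
  of_real k (\sum_i F i) = \sum_i of_real k (F i).
Proof. exact: (big_morph _ (@of_realD R k) (of_real0 R k)). Qed.

Definition of_real_seq (a : nat -> R) : nat -> K^o := fun n => of_real k (a n).

Lemma of_real_seq_bounded M (a : nat -> R) :
  (forall n, 0 <= a n <= M) -> bounded_by M (of_real_seq a).
Proof.
by move=> aM n; have /andP[a0 a1] := aM n; rewrite rnorm_of_real ger0_norm.
Qed.

Hypothesis Iexp : exponential I.

(** The [i]-th binary digits of the entries of [a] form a finite set [d i], and
    the series of the lifts of these sets, with weights [2 ^ - (i + 1)],
    converges absolutely in [I A]. *)
Lemma lift_unit_interval : exists2 C : R, 0 < C & forall a : nat -> R,
  (forall n, 0 <= a n <= 1) -> a n @[n --> \oo] --> 0 ->
  exists2 y : I A, embI y = lift_q (of_real_seq a) & rnorm y <= C.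
Proof.
have [C C0 CI] := bits_in_interp Iexp.
exists (2 * C); first by rewrite mulr_gt0.
move=> a a01 a0.
have /choice[d dE] i : exists d, bit d =1 (fun n => digit (a n) i).
  have e0 : 0 < 2^-1 ^+ i.+2 :> R by rewrite exprn_gt0.
  have /cvgrPdist_le/(_ _ e0)[N _ aN] := a0.
  apply: (@bits_of_pred _ N) => n; rewrite ltnNge; apply: contraL => Nn.
  have := aN n Nn; rewrite sub0r normrN ger0_norm; last by case/andP: (a01 n).
  move=> an; rewrite /digit -ltNge (le_lt_trans (remainder_le _ (a01 n)))//.
  apply: (@le_lt_trans _ _ (2 ^+ i * 2^-1 ^+ i.+2)); first by rewrite ler_wpM2l.
  by rewrite -(addn2 i) exprD mulrA -exprMn divff// expr1n mul1r expr2; lra.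
have /choice[y yE] i : exists y : I A,
    embI y = lift_q (bits R k (d i)) /\ rnorm y <= C.
  by have [y yd yC] := CI (d i); exists y.
pose u i : I A := of_real k (2^-1 ^+ i.+1) *: y i.
have [|n|l ul lM] := @abs_summable _ _ (I A) u (fun i => 2^-1 ^+ i * C) (2 * C)
    (banach_seq_complete (V := I A)).
- move=> i; have [_ yC] := yE i; rewrite rnormZ rnorm_half.
  rewrite ler_pM ?rnorm_ge0 ?exprn_ge0 ?invr_ge0//.
  by rewrite exprS ler_piMl ?exprn_ge0 ?invr_ge0// invf_le1 ?ler1n.
- by rewrite -mulr_suml ler_wpM2r ?sum_half_le// ltW.
exists l => //.
(* the slots of the sum are the sums of the slots *)
have slotS M (f : E -> K^o) : 0 < M -> couple_functional (A := A) M f ->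
    \sum_(i < n) of_real k (2^-1 ^+ i.+1) * f (lift_q (bits R k (d i)))
      @[n --> \oo] --> (f (embI l) : K^o).
  move=> M0 fM; have [fl _ _] := fM.
  pose g : {linear E -> K^o} := HB.pack f (GRing.isLinear.Build _ _ _ _ _ fl).
  rewrite (_ : (fun n => _) = (fun n => f (embI (\sum_(i < n) u i)))).
    exact: interp_functional_cvg M0 fM ul.
  apply/funext => n; rewrite -[f]/(g : E -> K^o) !linear_sum.
  by apply: eq_bigr => i _; rewrite !linearZ/=; have [-> _] := yE i.
have aB := of_real_seq_bounded a01.
apply: slots_ext => m.
- apply: lim_unique (slotS _ _ ltr01 (slot_q_functional R k m)) _.
  rewrite (slot_q_lift aB); apply/cvg_rnormP => e e0.
  have h0 : 2^-1 ^+ n @[n --> \oo] --> (0 : R).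
    by apply: cvg_expr; rewrite ger0_norm ?invr_ge0// invf_lt1// ltr1n.
  have /cvgrPdist_le/(_ e e0) := h0; apply: filterS => n.
  rewrite sub0r normrN ger0_norm ?exprn_ge0 ?invr_ge0// => en.
  rewrite (eq_bigr (fun i : 'I_n => of_real k (2^-1 ^+ i.+1 * (digit (a m) i)%:R))).
    rewrite -of_real_sum /of_real_seq -of_realN -of_realD rnorm_of_real.
    rewrite {1}(digits_sum (a m) n) addrAC subrr add0r.
    have /andP[r0 r1] := remainder01 n (a01 m).
    rewrite ger0_norm ?mulr_ge0 ?exprn_ge0 ?invr_ge0// (le_trans _ en)//.
    by rewrite ler_piMr// exprn_ge0// invr_ge0.
  move=> i _; rewrite (slot_q_lift (@bits_bounded R k (d i))) /bits dE of_realM.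
  by case: digit; rewrite ?of_real1 ?of_real0.
- apply: lim_unique (slotS _ _ (ltr0Sn R 1) (slot_u_functional R k m)) _.
  rewrite slot_u_lift; apply: cvg_near_cst; apply: nearW => n.
  by rewrite big1// => i _; rewrite slot_u_lift mulr0.
- apply: lim_unique (slotS _ _ (ltr0Sn R 1) (slot_v_functional R k m)) _.
  rewrite slot_v_lift; apply: cvg_near_cst; apply: nearW => n.
  by rewrite big1// => i _; rewrite slot_v_lift mulr0.
Qed.

End Lifting.

Section Lifting.
Variables (R : realType) (k : scalar_kind).
Local Notation K := (scalar_field R k).
Local Notation A := (l1_couple R k).
Local Notation E := (ambient_space R k).
Variable I : interpolation_method R k.
Local Notation embI := (emb (I A)).
Hypothesis Iexp : exponential I.

Lemma lift_qP M N (u v : nat -> K^o) (c : K) : bounded_by M u -> bounded_by N v ->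
  lift_q (c *: u + v) = c *: lift_q u + lift_q v.
Proof.
move=> uM vM; rewrite /lift_q (damp_linear _ uM vM).
by apply: slots_ext => n; rewrite /slot_q /slot_u /slot_v/= ?scaler0 ?addr0.
Qed.

Lemma lift_nonneg : exists2 C : R, 0 < C & forall M (a : nat -> R), 0 < M ->
  (forall n, 0 <= a n <= M) -> a n @[n --> \oo] --> 0 ->
  exists2 y : I A, embI y = lift_q (of_real_seq k a) & rnorm y <= C * M.
Proof.
have [C C0 CI] := lift_unit_interval Iexp; exists C => // M a M0 aM a0.
have Ma n : 0 <= M^-1 * a n <= 1.
  have /andP[an0 anM] := aM n.
  by rewrite mulr_ge0 ?invr_ge0 ?(ltW M0)//= ler_pdivrMl// mulr1.
have Ma0 : (M^-1 * a n) @[n --> \oo] --> 0.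
  by rewrite -(mulr0 M^-1); apply: cvgM => //; exact: cvg_cst.
have [y yE yC] := CI _ Ma Ma0.
exists (of_real k M *: y); last first.
  by rewrite rnormZ rnorm_of_real gtr0_norm// mulrC ler_wpM2r// ltW.
rewrite linearZ/= yE.
have aB := of_real_seq_bounded k aM.
have a1 := of_real_seq_bounded k Ma.
apply: slots_ext => n.
- rewrite (slot_q_lift aB) linearZ/= (slot_q_lift a1) /of_real_seq.
  rewrite [RHS](_ : _ = of_real k M * of_real k (M^-1 * a n))//.
  by rewrite -of_realM mulrA divff ?gt_eqF// mul1r.
- by rewrite linearZ/= !slot_u_lift scaler0.
- by rewrite linearZ/= !slot_v_lift scaler0.
Qed.

Lemma linear_comb4 (V W : lmodType K) (f : {linear V -> W}) x1 x2 c x3 x4 :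
  f (x1 - x2 + c *: (x3 - x4)) = f x1 - f x2 + c *: (f x3 - f x4).
Proof. by rewrite linearD linearB linearZ/= linearB. Qed.

Lemma slot_q_comb4 n (x1 x2 x3 x4 : E) c :
  slot_q n (x1 - x2 + c *: (x3 - x4)) =
  slot_q n x1 - slot_q n x2 + c * (slot_q n x3 - slot_q n x4).
Proof. exact: linear_comb4. Qed.

Lemma slot_u_comb4 n (x1 x2 x3 x4 : E) c :
  slot_u n (x1 - x2 + c *: (x3 - x4)) =
  slot_u n x1 - slot_u n x2 + c * (slot_u n x3 - slot_u n x4).
Proof. exact: linear_comb4. Qed.

Lemma slot_v_comb4 n (x1 x2 x3 x4 : E) c :
  slot_v n (x1 - x2 + c *: (x3 - x4)) =
  slot_v n x1 - slot_v n x2 + c * (slot_v n x3 - slot_v n x4).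
Proof. exact: linear_comb4. Qed.

Lemma posB_neg (x : R) : Num.max x 0 - Num.max (- x) 0 = x.
Proof. by have [x0|x0] := leP x 0; have [y0|y0] := leP (- x) 0; lra. Qed.

(** A scalar is a combination of four nonnegative reals, the positive and
    negative parts of its real and imaginary parts, none larger than its
    modulus. *)
Lemma lift_c0 : exists2 C : R, 0 < C & forall M (a : nat -> K^o), 0 <= M ->
  bounded_by M a -> c0_seq a ->
  exists2 y : I A, embI y = lift_q a & rnorm y <= C * M.
Proof.
have [C C0 CI] := lift_nonneg; exists (C *+ 4); first by rewrite mulrn_wgt0.
move=> M a; rewrite le_eqVlt => /predU1P[<-|M0] aM a0.
  exists 0; last by rewrite rnorm0 mulr0.
  have -> : a = 0.
    apply/funext => n; apply: rnorm0_eq0; apply/eqP.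
    by rewrite eq_le rnorm_ge0 aM.
  rewrite linear0; apply: slots_ext => n; rewrite linear0 ?slot_u_lift ?slot_v_lift//.
  by rewrite (@slot_q_lift R k 0)// => m; rewrite rnorm0.
have part (p : nat -> R) : (forall n, `|p n| <= rnorm (a n)) ->
    exists2 y : I A, embI y = lift_q (of_real_seq k (fun n => Num.max (p n) 0))
                   & rnorm y <= C * M.
  move=> pa.
  have p0 n : 0 <= Num.max (p n) 0 <= rnorm (a n).
    rewrite le_max lexx orbT/= ge_max rnorm_ge0 andbT.
    exact: le_trans (ler_norm _) (pa n).
  apply: (CI _ _ M0).
    by move=> n; have /andP[-> /le_trans->] := p0 n.
  move/cvg_rnormP: a0 => a0; apply/cvgrPdist_le => e /a0; apply: filterS => n.
  have /andP[pn0 pna] := p0 n.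
  by rewrite !sub0r normrN rnormN ger0_norm//; exact: le_trans.
have [y1 y1E y1C] := part (fun n => scalar_re (a n)) (fun n => scalar_re_le _).
have [|y2 y2E y2C] := part (fun n => - scalar_re (a n)).
  by move=> n; rewrite normrN scalar_re_le.
have [y3 y3E y3C] := part (fun n => scalar_im (a n)) (fun n => scalar_im_le _).
have [|y4 y4E y4C] := part (fun n => - scalar_im (a n)).
  by move=> n; rewrite normrN scalar_im_le.
exists (y1 - y2 + imag_unit R k *: (y3 - y4)).
  rewrite linear_comb4 y1E y2E y3E y4E.
  have pB (p : nat -> R) : (forall n, `|p n| <= rnorm (a n)) ->
      bounded_by M (of_real_seq k (fun n => Num.max (p n) 0)).
    move=> pa; apply: of_real_seq_bounded => n.
    rewrite le_max lexx orbT/= ge_max (le_trans (ler_norm _) (le_trans (pa n) (aM n))).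
    exact: ltW.
  apply: slots_ext => n.
  - rewrite slot_q_comb4 (slot_q_lift aM).
    rewrite (slot_q_lift (pB _ (fun n => scalar_re_le _))).
    rewrite (slot_q_lift (pB (fun n => - scalar_re (a n)) _)); last first.
      by move=> m; rewrite normrN scalar_re_le.
    rewrite (slot_q_lift (pB _ (fun n => scalar_im_le _))).
    rewrite (slot_q_lift (pB (fun n => - scalar_im (a n)) _)); last first.
      by move=> m; rewrite normrN scalar_im_le.
    rewrite /of_real_seq -!of_realN -!of_realD !posB_neg.
    by rewrite -scalarE.
  - by rewrite slot_u_comb4 !slot_u_lift subrr mulr0 addr0.
  - by rewrite slot_v_comb4 !slot_v_lift subrr mulr0 addr0.
have y34 : rnorm (imag_unit R k *: (y3 - y4)) <= C * M + C * M.
  rewrite rnormZ (le_trans (ler_wpM2r (rnorm_ge0 _) (rnorm_imag_unit R k)))// mul1r.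
  exact: le_trans (rnormB _ _) (lerD y3C y4C).
apply: le_trans (rnormD _ _) _.
apply: le_trans (lerD (le_trans (rnormB _ _) (lerD y1C y2C)) y34) _.
by rewrite mulrnAl !mulrS mulr0n addr0 !addrA.
Qed.

End Lifting.

(** * The complemented copy of c0 *)

Section Complemented.
Variables (R : realType) (k : scalar_kind).
Local Notation K := (scalar_field R k).
Local Notation A := (l1_couple R k).
Local Notation E := (ambient_space R k).
Variable I : interpolation_method R k.
Local Notation embI := (emb (I A)).
Hypothesis Iexp : exponential I.

Definition q_of (y : I A) : nat -> K^o := fun n => slot_q n (embI y).

Lemma q_of_linear : linear q_of.
Proof.
by move=> a y z; apply/funext => n; rewrite /q_of linearP/= slot_q_linear.
Qed.

(** The values of [slot_q] on both spaces of the couple are null sequences, and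
    [I A] lies in the sum. *)
Lemma q_of_c0 y : c0_seq (q_of y).
Proof.
have [|z0 [z1 zE]] := @sub_sum _ _ I A (embI y); first by exists y.
have -> : q_of y = qcoord z0 + qcoord z1.
  apply/funext => n; rewrite /q_of -zE.
  rewrite -[emb (space0 A) z0]/(embed0 z0) -[emb (space1 A) z1]/(embed1 z1).
  rewrite -[embed0 z0]scale1r slot_q_linear scale1r.
  by rewrite slot_q0 slot_q1.
rewrite /c0_seq/= -[0 in X in _ --> X](addr0 (0 : K^o)).
by apply: cvgD; exact: qcoord_c0.
Qed.

Lemma q_of_bounded : exists2 C : R, 0 < C & forall y, bounded_by (C * rnorm y) (q_of y).
Proof.
have [C C0 CI] := interp_functional_le A I; exists C => // y n.
by have := CI _ _ ltr01 (slot_q_functional R k n) y; rewrite mulr1.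
Qed.

Lemma c0_bounded (a : nat -> K^o) : c0_seq a -> exists2 M : R, 0 <= M & bounded_by M a.
Proof.
move=> /cvg_rnormP/(_ 1 ltr01)[N _ aN].
have s0 : 0 <= \sum_(i < N) rnorm (a i) by apply: sumr_ge0 => i _; exact: rnorm_ge0.
exists (1 + \sum_(i < N) rnorm (a i)); first by rewrite addr_ge0.
move=> n; have [nN|Nn] := ltnP n N.
  rewrite (bigD1 (Ordinal nN))//= addrCA lerDl addr_ge0//.
  by apply: sumr_ge0 => i _; exact: rnorm_ge0.
by have := aN n Nn; rewrite sub0r rnormN => /le_trans; apply; rewrite lerDl.
Qed.

Definition lifted_c0 : set (I A) :=
  [set y | exists2 a, c0_seq a & embI y = lift_q a].

Lemma q_of_lift a y : c0_seq a -> embI y = lift_q a -> q_of y = a.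
Proof.
move=> /c0_bounded[M _ aM] yE; apply/funext => n.
by rewrite /q_of yE (slot_q_lift aM).
Qed.

(** The projection sends [y] to the lift of the sequence [q_of y].  The lift
    given by [lift_c0] is unique because [embI] is injective, and for the same
    reason it depends linearly on [y]. *)
Lemma lifted_c0_complemented : complemented lifted_c0.
Proof.
have [C C0 CI] := lift_c0 Iexp; have [D D0 DI] := q_of_bounded.
have /choice[P PE] y : exists y' : I A,
    embI y' = lift_q (q_of y) /\ rnorm y' <= C * (D * rnorm y).
  have [|y' y'E y'C] := CI (D * rnorm y) _ _ (DI y) (q_of_c0 y).
    by rewrite mulr_ge0 ?rnorm_ge0// ltW.
  by exists y'.
have Pl : linear P.
  move=> a y z; apply: (@emb_inj _ _ _ (I A)); rewrite linearP.
  have [-> _] := PE (a *: y + z); have [-> _] := PE y; have [-> _] := PE z.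
  by rewrite q_of_linear (lift_qP _ (DI y) (DI z)).
pose Q : {linear I A -> I A} := HB.pack P (GRing.isLinear.Build _ _ _ _ _ Pl).
exists Q; split.
- apply: (@bounded_linear_cont _ _ _ _ Q (C * D)) => y.
  by have [_] := PE y; rewrite mulrA.
- move=> y; apply: (@emb_inj _ _ _ (I A)).
  have [-> _] := PE (P y); have [PyE _] := PE y.
  by rewrite (q_of_lift (q_of_c0 y) PyE) PyE.
- apply/seteqP; split=> [_ [y _ <-]|y [a a0 yE]].
    by have [PyE _] := PE y; exists (q_of y) => //; exact: q_of_c0.
  exists y => //; apply: (@emb_inj _ _ _ (I A)).
  by have [-> _] := PE y; rewrite (q_of_lift a0 yE).
Qed.

(** [q_of] is bounded, and the bound of the lift in [lift_c0] is the lower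
    estimate. *)
Lemma lifted_c0_isomorphic : isomorphic_to_c0 lifted_c0.
Proof.
have [C C0 CI] := lift_c0 Iexp; have [D D0 DI] := q_of_bounded.
exists q_of; split.
- by move=> a y z _ _; exact: q_of_linear.
- apply/seteqP; split=> [_ [y _ <-]|a a0]; first exact: q_of_c0.
  have [M M0 aM] := c0_bounded a0; have [y yE _] := CI M a M0 aM a0.
  by exists y; [exists a|exact: q_of_lift yE].
exists C^-1, D; split; rewrite ?invr_gt0// => y [a a0 yE].
have supD : (sup_norm (q_of y) <= (D * rnorm y)%:E)%E.
  by apply: ge_ereal_sup => _ [n _ <-]; rewrite lee_fin; exact: DI.
rewrite supD andbT.
have supn n : ((rnorm (q_of y n))%:E <= sup_norm (q_of y))%E.
  by apply: ereal_sup_ubound; exists n.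
have sup0 : (0 <= sup_norm (q_of y))%E.
  by apply: le_trans (supn 0); rewrite lee_fin rnorm_ge0.
have supE : sup_norm (q_of y) = (fine (sup_norm (q_of y)))%:E.
  by rewrite fineK// ge0_fin_numE// (le_lt_trans supD)// ltry.
have [||y' y'E y'C] := CI (fine (sup_norm (q_of y))) (q_of y) _ _ (q_of_c0 y).
- exact: fine_ge0.
- by move=> n; rewrite -lee_fin -supE.
have yy' : y = y'.
  by apply: (@emb_inj _ _ _ (I A)); rewrite y'E (q_of_lift a0 yE).
by rewrite supE lee_fin ler_pdivrMl// {1}yy'.
Qed.

End Complemented.

Theorem theorem2 (R : realType) (k : scalar_kind) :
  exists A : banach_couple R k,
    isometric_to_l1 (space0 A) /\ isometric_to_l1 (space1 A) /\
    forall I : interpolation_method R k, exponential I ->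
      exists Y : set (I A), complemented Y /\ isomorphic_to_c0 Y.
Proof.
exists (l1_couple R k); split; first exact: l1_space_isometric.
split=> [|I Iexp]; first exact: l1_space_isometric.
exists (@lifted_c0 R k I); split.
  exact: lifted_c0_complemented.
exact: lifted_c0_isomorphic.
Qed.
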